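(* Let $\mathcal{A}$ be a (unital) involutive algebra. (i) The self-adjoint normalized elements of $\mathcal{A}\otimes\mathcal{A}^{\mathrm{op}}$ form a semi-group $\mathrm{Pert}(\mathcal{A})$ under multiplication. (ii) The transitivity of inner fluctuations (i.e. the fact that inner fluctuations of inner fluctuations are inner fluctuations) corresponds to the semi-group law in the semi-group $\mathrm{Pert}(\mathcal{A})$. (iii) The semi-group $\mathrm{Pert}(\mathcal{A})$ acts on real spectral triples through the homomorphism $\mu:\mathrm{Pert}(\mathcal{A})\to\mathrm{Pert}(\mathcal{A}\otimes\hat{\mathcal{A}})$ given by $$A\in\mathcal{A}\otimes\mathcal{A}^{\mathrm{op}}\ \mapsto\ \mu(A)=A\otimes\hat A\in(\mathcal{A}\otimes\hat{\mathcal{A}})\otimes(\mathcal{A}\otimes\hat{\mathcal{A}})^{\mathrm{op}}.$$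
   Context: $\mathcal{A}^{\mathrm{op}}$ is the opposite algebra and $x\mapsto x^{\mathrm{op}}$ the canonical anti-isomorphism; the product in $\mathcal{A}\otimes\mathcal{A}^{\mathrm{op}}$ is $(x\otimes y^{\mathrm{op}})(a\otimes b^{\mathrm{op}})=xa\otimes(by)^{\mathrm{op}}$. An element $\sum_j a_j\otimes b_j^{\mathrm{op}}$ is normalized if $\sum_j a_jb_j=1$, and self-adjoint if it is fixed by the antilinear automorphism $\sum_j a_j\otimes b_j^{\mathrm{op}}\mapsto\sum_j b_j^*\otimes(a_j^* )^{\mathrm{op}}$. Real spectral triple $(\mathcal{A},\mathcal{H},D;J)$ (first-order condition $[[D,a],JbJ^{-1}]=0$ not assumed): $\mathcal{A}$ is represented by bounded operators on a Hilbert space $\mathcal{H}$, $D$ is a self-adjoint operator with compact resolvent such that each $a\in\mathcal{A}$ preserves $\mathrm{Dom}(D)$ and $[D,a]$ is bounded, and $J$ is an antilinear isometry of $\mathcal{H}$ onto itself with $J^2=\pm1$, $JDJ^{-1}=\epsilon D$ for some $\epsilon\in\{\pm1\}$, and $[a,JbJ^{-1}]=0$ for all $a,b\in\mathcal{A}$. Notation: $\hat a=JaJ^{-1}$, $\hat{\mathcal{A}}=J\mathcal{A}J^{-1}$ (an involutive algebra of operators commuting with $\mathcal{A}$); $\mathcal{A}\otimes\hat{\mathcal{A}}$ acts on $\mathcal{H}$ by $a\otimes\hat b\mapsto a\hat b$. For $A=\sum_i a_i\otimes b_i^{\mathrm{op}}$, $\hat A=\sum_i\hat a_i\otimes\hat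 b_i^{\mathrm{op}}$ and $A\otimes\hat A=\sum_{i,j}a_i\hat a_j\otimes(b_i\hat b_j)^{\mathrm{op}}$. $\mathrm{Pert}(\mathcal{A}\otimes\hat{\mathcal{A}})$ is defined as $\mathrm{Pert}(\mathcal{A})$ with $\mathcal{A}\otimes\hat{\mathcal{A}}$ in place of $\mathcal{A}$. Inner fluctuations: for an algebra $\mathcal{B}$ acting on $\mathcal{H}$, the inner fluctuation of $D$ by a self-adjoint normalized element $\sum_i x_i\otimes y_i^{\mathrm{op}}\in\mathcal{B}\otimes\mathcal{B}^{\mathrm{op}}$ is $D+\sum_i x_i[D,y_i]$ (equal to $\sum_i x_iDy_i$ by normalization). For an ordinary spectral triple one takes $\mathcal{B}=\mathcal{A}$. For a real spectral triple, the inner fluctuation of $D$ by $A=\sum_i a_i\otimes b_i^{\mathrm{op}}\in\mathrm{Pert}(\mathcal{A})$ is $D+\sum_{i,j}a_i\hat a_j[D,b_i\hat b_j]$, i.e. the one obtained with $\mathcal{B}=\mathcal{A}\otimes\hat{\mathcal{A}}$ and the element $A\otimes\hat A$. *)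

(* Defs.v *)
From HB Require Import structures.
From mathcomp Require Import all_boot all_order all_algebra.
From mathcomp Require Import generic_quotient sesquilinear complex.
From mathcomp Require Import boolp classical_sets functions reals topology.
From mathcomp Require Import normedtype ring.

Set Implicit Arguments.
Unset Strict Implicit.
Unset Printing Implicit Defensive.

Import Order.TTheory GRing.Theory Num.Theory Num.Def.
Import numFieldNormedType.Exports.

Local Open Scope quotient_scope.
Local Open Scope classical_set_scope.
Local Open Scope ring_scope.

(* Unital complex *-algebras. MathComp's algType excludes the zero algebra,
   which is needed here (J A J^-1 is zero when H = 0), and Hierarchy Builder
   does not allow a new common child of PzRing and Lmodule; hence the scalar
   multiplication cscale is a field of the mixin. *)
HB.mixin Record isInvolutiveAlgebra (R : realType) A of GRing.PzRing A := {
  cscale : R[i] -> A -> A;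
  cscaleA : forall c d a, cscale c (cscale d a) = cscale (c * d) a;
  cscale1 : forall a, cscale 1 a = a;
  cscaleDr : forall c, {morph cscale c : a b / a + b};
  cscaleDl : forall a, {morph cscale^~ a : c d / c + d};
  cscaleAl : forall c (a b : A), cscale c (a * b) = cscale c a * b;
  cscaleAr : forall c (a b : A), cscale c (a * b) = a * cscale c b;
  star : A -> A;
  starK : involutive star;
  starD : {morph star : a b / a + b};
  starZ : forall c a, star (cscale c a) = cscale c^* (star a);
  starM : forall a b : A, star (a * b) = star b * star a
}.

#[short(type="invAlgType")]
HB.structure Definition InvolutiveAlgebra (R : realType) :=
  {A of GRing.PzRing A & isInvolutiveAlgebra R A}.

Lemma star1 (R : realType) (A : invAlgType R) : star (1 : A) = 1.
Proof.
by have := starM (star 1) (1 : A); rewrite mulr1 starK mulr1 => <-.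
Qed.

(* The converse ring A^c is the opposite algebra, a |-> (a : A^c) being the
   canonical anti-isomorphism. *)
Section ConverseInvolutive.
Variables (R : realType) (A : invAlgType R).

Let scaleAl c (a b : A^c) : cscale c (a * b : A) = (cscale c (a : A) : A^c) * b.
Proof. exact: (@cscaleAr R A). Qed.

Let scaleAr c (a b : A^c) : cscale c (a * b : A) = a * (cscale c (b : A) : A^c).
Proof. exact: (@cscaleAl R A). Qed.

Let starM' (a b : A^c) :
  (star (a * b : A) : A^c) = (star (b : A) : A^c) * (star (a : A) : A^c).
Proof. exact: (@starM R A). Qed.

HB.instance Definition _ := isInvolutiveAlgebra.Build R A^c
  (@cscaleA R A) (@cscale1 R A) (@cscaleDr R A) (@cscaleDl R A)
  scaleAl scaleAr (@starK R A) (@starD R A) (@starZ R A) starM'.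

End ConverseInvolutive.

(* Finite families of pairs, representing the sums of the a_i (x) b_i, are
   identified when no balanced biadditive map separates them. *)
Section Tensor.
Variables (R : realType) (A B : invAlgType R).

Definition balanced (V : zmodType) (f : A -> B -> V) : Prop :=
  [/\ forall b, {morph f^~ b : a a' / a + a'},
      forall a, {morph f a : b b' / b + b'} &
      forall c a b, f (cscale c a) b = f a (cscale c b)].

Definition tensor_eqv (s t : seq (A * B)) : bool :=
  `[< forall (V : zmodType) (f : A -> B -> V), balanced f ->
        \sum_(p <- s) f p.1 p.2 = \sum_(p <- t) f p.1 p.2 >].

Lemma tensor_eqv_refl : reflexive tensor_eqv.
Proof. by move=> s; apply/asboolP. Qed.

Lemma tensor_eqv_sym : symmetric tensor_eqv.
Proof.
by move=> s t; apply/asboolP/asboolP => st V f bf; rewrite (st _ _ bf).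
Qed.

Lemma tensor_eqv_trans : transitive tensor_eqv.
Proof.
move=> t s u /asboolP st /asboolP tu; apply/asboolP => V f bf.
by rewrite (st _ _ bf) (tu _ _ bf).
Qed.

Canonical tensor_eqv_rel :=
  EquivRel tensor_eqv tensor_eqv_refl tensor_eqv_sym tensor_eqv_trans.

Definition tensor : Type := {eq_quot tensor_eqv}.
HB.instance Definition _ := Choice.on tensor.
HB.instance Definition _ := EqQuotient.on tensor.

Definition tens (a : A) (b : B) : tensor := \pi_tensor [:: (a, b)].

(* The linear extension of f; meaningful only when f is balanced. *)
Definition tlift (V : zmodType) (f : A -> B -> V) (X : tensor) : V :=
  \sum_(p <- repr X) f p.1 p.2.

Lemma tlift_pi (V : zmodType) (f : A -> B -> V) s : balanced f ->
  tlift f (\pi_tensor s) = \sum_(p <- s) f p.1 p.2.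
Proof.
move=> bf; rewrite /tlift.
have /eqmodP/asboolP : repr (\pi_tensor s) = s %[mod tensor] by rewrite reprK.
exact.
Qed.

Lemma tensor_ext (X Y : tensor) :
  (forall (V : zmodType) (f : A -> B -> V), balanced f ->
     tlift f X = tlift f Y) -> X = Y.
Proof.
move=> XY; rewrite -[X]reprK -[Y]reprK; apply/eqmodP/asboolP => V f bf.
exact: XY.
Qed.

Lemma tlift_tens (V : zmodType) (f : A -> B -> V) a b : balanced f ->
  tlift f (tens a b) = f a b.
Proof. by move=> bf; rewrite tlift_pi // big_seq1. Qed.

Let zero : tensor := \pi_tensor [::].
Let add (X Y : tensor) : tensor := \pi_tensor (repr X ++ repr Y).
Let opp (X : tensor) : tensor :=
  \pi_tensor [seq (- p.1, p.2) | p <- repr X].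
Definition tscale (c : R[i]) (X : tensor) : tensor :=
  \pi_tensor [seq (cscale c p.1, p.2) | p <- repr X].

Let tlift_zero (V : zmodType) (f : A -> B -> V) : balanced f ->
  tlift f zero = 0.
Proof. by move=> bf; rewrite tlift_pi // big_nil. Qed.

Let tlift_add (V : zmodType) (f : A -> B -> V) X Y : balanced f ->
  tlift f (add X Y) = tlift f X + tlift f Y.
Proof. by move=> bf; rewrite tlift_pi // big_cat. Qed.

Let balancedN (V : zmodType) (f : A -> B -> V) a b : balanced f ->
  f (- a) b = - f a b.
Proof.
case=> fl _ _; apply/eqP; rewrite -addr_eq0 -fl addNr.
by rewrite -(inj_eq (addrI (f 0 b))) -fl !addr0.
Qed.

Let tlift_opp (V : zmodType) (f : A -> B -> V) X : balanced f ->
  tlift f (opp X) = - tlift f X.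
Proof.
move=> bf; rewrite tlift_pi // big_map /tlift -sumrN.
by apply: eq_bigr => p _; rewrite balancedN.
Qed.

Let tlift_scale (V : zmodType) (f : A -> B -> V) c X : balanced f ->
  tlift f (tscale c X) = tlift (fun a b => f (cscale c a) b) X.
Proof. by move=> bf; rewrite tlift_pi // big_map. Qed.

Let balancedZ (V : zmodType) (f : A -> B -> V) c : balanced f ->
  balanced (fun a b => f (cscale c a) b).
Proof.
case=> fl fr fc; split=> [b a a'|a b b'|c' a b] /=.
- by rewrite cscaleDr fl.
- by rewrite fr.
- by rewrite cscaleA mulrC -cscaleA fc.
Qed.

Let addA : associative add.
Proof.
by move=> X Y Z; apply: tensor_ext => V f bf; rewrite !tlift_add // addrA.
Qed.
Let addC : commutative add.
Proof.
by move=> X Y; apply: tensor_ext => V f bf; rewrite !tlift_add // addrC.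
Qed.
Let add0 : left_id zero add.
Proof.
move=> X; apply: tensor_ext => V f bf.
by rewrite tlift_add // tlift_zero // add0r.
Qed.
Let addN : left_inverse zero opp add.
Proof.
move=> X; apply: tensor_ext => V f bf.
by rewrite tlift_add // tlift_opp // tlift_zero // addNr.
Qed.
HB.instance Definition _ := GRing.isZmodule.Build tensor addA addC add0 addN.

Lemma tscaleA c d X : tscale c (tscale d X) = tscale (c * d) X.
Proof.
apply: tensor_ext => V f bf; rewrite !tlift_scale //; last exact: balancedZ.
by apply: eq_bigr => p _; rewrite cscaleA.
Qed.
Lemma tscale1 X : tscale 1 X = X.
Proof. apply: tensor_ext => V f bf; rewrite tlift_scale //.
by apply: eq_bigr => p _; rewrite cscale1.
Qed.
Lemma tscaleDr c : {morph tscale c : X Y / X + Y}.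
Proof.
move=> X Y; apply: tensor_ext => V f bf.
rewrite tlift_scale // [in RHS]tlift_add // !tlift_scale //.
by rewrite [LHS]tlift_add //; exact: balancedZ.
Qed.
Lemma tscaleDl X : {morph tscale^~ X : c d / c + d}.
Proof.
move=> c d /=; apply: tensor_ext => V f bf.
rewrite [RHS]tlift_add // !tlift_scale // /tlift -big_split /=.
by apply: eq_bigr => p _; rewrite cscaleDl; case: bf => ->.
Qed.

Lemma tliftD (V : zmodType) (f : A -> B -> V) : balanced f ->
  {morph tlift f : X Y / X + Y}.
Proof. by move=> bf X Y; exact: tlift_add. Qed.

Lemma tlift0 (V : zmodType) (f : A -> B -> V) : balanced f -> tlift f 0 = 0.
Proof. exact: tlift_zero. Qed.

Lemma tliftZ (V : zmodType) (f : A -> B -> V) c X : balanced f ->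
  tlift f (tscale c X) = tlift (fun a b => f (cscale c a) b) X.
Proof. exact: tlift_scale. Qed.

Lemma tlift_sum (V : zmodType) (f : A -> B -> V) (s : seq (A * B)) :
  balanced f ->
  tlift f (\sum_(p <- s) tens p.1 p.2) = \sum_(p <- s) f p.1 p.2.
Proof.
move=> bf; elim: s => [|p s IH]; first by rewrite !big_nil tlift0.
by rewrite !big_cons tliftD // tlift_tens // IH.
Qed.

Lemma tens_balanced : balanced tens.
Proof.
split=> [b a a'|a b b'|c a b] /=; apply: tensor_ext => V f bf;
  rewrite ?tliftD // !tlift_tens //;
  by case: bf => fl fr fc; rewrite ?fl ?fr ?fc.
Qed.

Lemma tensorE X : X = \sum_(p <- repr X) tens p.1 p.2.
Proof. by apply: tensor_ext => V f bf; rewrite tlift_sum. Qed.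

Lemma tensDl b : {morph tens^~ b : a a' / a + a'}.
Proof. by case: tens_balanced. Qed.

Lemma tensDr a : {morph tens a : b b' / b + b'}.
Proof. by case: tens_balanced. Qed.

Lemma scale_tens c a b : tscale c (tens a b) = tens (cscale c a) b.
Proof.
apply: tensor_ext => V f bf; rewrite tliftZ // !tlift_tens //.
exact: balancedZ.
Qed.

Lemma tensZr c a b : tens a (cscale c b) = tscale c (tens a b).
Proof. by rewrite scale_tens; case: tens_balanced => _ _ ->. Qed.

Lemma tensor_ind (P : tensor -> Prop) :
  P 0 -> (forall a b X, P X -> P (tens a b + X)) -> forall X, P X.
Proof.
move=> P0 PD X; rewrite [X]tensorE.
by elim: (repr X) => [|p s IH]; rewrite ?big_nil ?big_cons //; exact: PD.
Qed.

End Tensor.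

Section TensorAlgebra.
Variables (R : realType) (A B : invAlgType R).

Let tscale0 c : tscale c 0 = 0 :> tensor A B.
Proof. by apply: (addrI (tscale c 0)); rewrite -tscaleDr !addr0. Qed.

Let mul (X Y : tensor A B) : tensor A B :=
  tlift (fun x y => tlift (fun a b => tens (x * a) (y * b)) Y) X.

Let mul_tens_balanced x y :
  balanced (fun a b => tens (x * a : A) (y * b : B)).
Proof.
split=> [b a a'|a b b'|c a b] /=.
- by rewrite mulrDr tensDl.
- by rewrite mulrDr tensDr.
- by rewrite -!cscaleAr tensZr scale_tens.
Qed.

Let mul_balanced Y :
  balanced (fun x y => tlift (fun a b => tens (x * a : A) (y * b : B)) Y).
Proof.
split=> [b a a'|a b b'|c a b] /=; rewrite /tlift -?big_split /=;
  apply: eq_bigr => p _.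
- by rewrite mulrDl tensDl.
- by rewrite mulrDl tensDr.
- by rewrite -!cscaleAl tensZr scale_tens.
Qed.

Let mulD_l : left_distributive mul +%R.
Proof. by move=> X Y Z; rewrite /mul tliftD //; exact: mul_balanced. Qed.
Let mulD_r : right_distributive mul +%R.
Proof.
move=> X Y Z; rewrite /mul /tlift -big_split /=; apply: eq_bigr => p _.
exact: (tliftD (mul_tens_balanced _ _)).
Qed.
Let mul0_l Y : mul 0 Y = 0.
Proof. by rewrite /mul tlift0 //; exact: mul_balanced. Qed.
Let mul0_r X : mul X 0 = 0.
Proof.
rewrite /mul /tlift big1 // => p _; exact: (tlift0 (mul_tens_balanced _ _)).
Qed.
Let mulE x y a b : mul (tens x y) (tens a b) = tens (x * a) (y * b).
Proof.
rewrite /mul tlift_tens; last exact: mul_balanced.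
by rewrite tlift_tens //; exact: mul_tens_balanced.
Qed.
Let mulA : associative mul.
Proof.
move=> X Y Z.
elim/tensor_ind: X => [|x x' X IH]; first by rewrite !mul0_l.
rewrite !mulD_l IH; congr (_ + _) => {X IH}.
elim/tensor_ind: Y => [|y y' Y IHY]; first by rewrite !(mul0_l, mul0_r).
rewrite mulD_l !mulD_r mulD_l IHY; congr (_ + _) => {Y IHY}.
elim/tensor_ind: Z => [|z z' Z IHZ]; first by rewrite !mul0_r.
by rewrite !mulD_r IHZ !mulE !mulrA.
Qed.
Let mul1_l : left_id (tens 1 1) mul.
Proof.
elim/tensor_ind => [|x x' X IH]; first by rewrite mul0_r.
by rewrite mulD_r IH mulE !mul1r.
Qed.
Let mul1_r : right_id (tens 1 1) mul.
Proof.
elim/tensor_ind => [|x x' X IH]; first by rewrite mul0_l.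
by rewrite mulD_l IH mulE !mulr1.
Qed.
HB.instance Definition _ :=
  GRing.Zmodule_isPzRing.Build (tensor A B) mulA mul1_l mul1_r mulD_l mulD_r.

Lemma mul_tens x y a b :
  (tens x y : tensor A B) * tens a b = tens (x * a) (y * b).
Proof. exact: mulE. Qed.

Lemma tensor1E : (1 : tensor A B) = tens 1 1.
Proof. by []. Qed.

Let tstar (X : tensor A B) : tensor A B :=
  tlift (fun a b => tens (star a) (star b)) X.

Let star_balanced : balanced (fun a b => tens (star a : A) (star b : B)).
Proof.
split=> [b a a'|a b b'|c a b] /=.
- by rewrite starD tensDl.
- by rewrite starD tensDr.
- by rewrite !starZ tensZr scale_tens.
Qed.

Let tscaleAl (c : R[i]) (X Y : tensor A B) : tscale c (X * Y) = tscale c X * Y.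
Proof.
elim/tensor_ind: X => [|x x' X IH]; first by rewrite mul0r !tscale0 mul0r.
rewrite mulrDl !tscaleDr IH mulrDl; congr (_ + _) => {X IH}.
elim/tensor_ind: Y => [|y y' Y IHY]; first by rewrite !mulr0 tscale0.
rewrite !mulrDr tscaleDr IHY; congr (_ + _).
by rewrite mul_tens !scale_tens mul_tens cscaleAl.
Qed.
Let tscaleAr (c : R[i]) (X Y : tensor A B) : tscale c (X * Y) = X * tscale c Y.
Proof.
elim/tensor_ind: X => [|x x' X IH]; first by rewrite !mul0r tscale0.
rewrite mulrDl !tscaleDr IH mulrDl; congr (_ + _) => {X IH}.
elim/tensor_ind: Y => [|y y' Y IHY]; first by rewrite mulr0 !tscale0 mulr0.
rewrite !(mulrDr, tscaleDr) IHY; congr (_ + _).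
by rewrite mul_tens !scale_tens mul_tens cscaleAr.
Qed.
Let tstarD : {morph tstar : X Y / X + Y}.
Proof. by move=> X Y; rewrite /tstar tliftD //; exact: star_balanced. Qed.
Let tstar0 : tstar 0 = 0.
Proof. by rewrite /tstar tlift0 //; exact: star_balanced. Qed.
Let tstarE a b : tstar (tens a b) = tens (star a) (star b).
Proof. by rewrite /tstar tlift_tens //; exact: star_balanced. Qed.
Let tstarK : involutive tstar.
Proof.
elim/tensor_ind => [|x x' X IH]; first by rewrite !tstar0.
by rewrite !tstarD IH !tstarE !starK.
Qed.
Let tstarZ (c : R[i]) (X : tensor A B) :
  tstar (tscale c X) = tscale c^* (tstar X).
Proof.
elim/tensor_ind: X => [|x x' X IH]; first by rewrite !(tscale0, tstar0).
rewrite tscaleDr !tstarD IH tscaleDr; congr (_ + _).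
by rewrite scale_tens !tstarE starZ scale_tens.
Qed.
Let tstarM (X Y : tensor A B) : tstar (X * Y) = tstar Y * tstar X.
Proof.
elim/tensor_ind: X => [|x x' X IH]; first by rewrite !(mul0r, tstar0, mulr0).
rewrite mulrDl !tstarD IH mulrDr; congr (_ + _) => {X IH}.
elim/tensor_ind: Y => [|y y' Y IHY]; first by rewrite !(mulr0, tstar0, mul0r).
rewrite mulrDr !tstarD IHY mulrDl; congr (_ + _).
by rewrite mul_tens !tstarE mul_tens !starM.
Qed.
HB.instance Definition _ := isInvolutiveAlgebra.Build R (tensor A B)
  (@tscaleA R A B) (@tscale1 R A B) (@tscaleDr R A B) (@tscaleDl R A B)
  tscaleAl tscaleAr tstarK tstarD tstarZ tstarM.

Lemma star_tens a b : star (tens a b : tensor A B) = tens (star a) (star b).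
Proof. exact: tstarE. Qed.

End TensorAlgebra.

(* Self-adjointness in Pert refers to swap_star, not to the involution star of
   the algebra tensor A A^c. *)
Section Pert.
Variables (R : realType) (A : invAlgType R).

Definition tmul (X : tensor A A^c) : A :=
  tlift (fun (a : A) (b : A^c) => a * (b : A)) X.

Definition swap_star (X : tensor A A^c) : tensor A A^c :=
  tlift (fun (a : A) (b : A^c) => tens (star (b : A)) (star a : A^c)) X.

Definition normalized (X : tensor A A^c) : Prop := tmul X = 1.

Definition selfadjoint_elt (X : tensor A A^c) : Prop := swap_star X = X.

Definition Pert : set (tensor A A^c) :=
  [set X | normalized X /\ selfadjoint_elt X].


Lemma tmul_balanced : balanced (fun (a : A) (b : A^c) => a * (b : A)).
Proof.
split=> [b a a'|a b b'|c a b] /=.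
- exact: mulrDl.
- exact: mulrDr.
- by rewrite -cscaleAl; exact: cscaleAr.
Qed.

Lemma swap_star_balanced :
  balanced (fun (a : A) (b : A^c) => tens (star (b : A)) (star a : A^c)).
Proof.
split=> [b a a'|a b b'|c a b] /=.
- by rewrite starD; exact: tensDr.
- by rewrite (@starD R A); exact: tensDl.
- by rewrite starZ (@starZ R A) -scale_tens; exact: tensZr.
Qed.

End Pert.

Arguments Pert {R} A _.

(* The inner product is linear in its first argument. *)
HB.mixin Record isHilbert (R : realType) H
    of CompleteNormedModule R[i] H := {
  dotp : {dot H for conjC};
  dotp_norm : forall x : H, dotp x x = `|x| ^+ 2
}.

#[short(type="hilbertType")]
HB.structure Definition Hilbert (R : realType) :=
  {H of CompleteNormedModule R[i] H & isHilbert R H}.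

Section Operators.
Variables (R : realType) (H : hilbertType R).

Definition bounded_op (T : H -> H) : Prop :=
  linear T /\ exists M : R[i], forall x, `|T x| <= M * `|x|.

Definition compact_op (T : H -> H) : Prop :=
  linear T /\ compact (closure (T @` [set x | `|x| <= 1])).

(* A possibly unbounded operator; the values of op outside dom are
   irrelevant. *)
Record operator := Operator { dom : set H; op :> H -> H }.

Definition op_eq (D E : operator) : Prop :=
  dom D = dom E /\ forall x, dom D x -> D x = E x.

Definition linear_operator (D : operator) : Prop :=
  dom D 0 /\ forall (c : R[i]) x y, dom D x -> dom D y ->
    dom D (c *: x + y) /\ D (c *: x + y) = c *: D x + D y.

(* Dom D is dense, and the graph of D equals that of its adjoint. *)
Definition self_adjoint (D : operator) : Prop :=
  [/\ linear_operator D,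
      closure (dom D) = [set: H] &
      forall y z : H,
        (forall x, dom D x -> dotp (D x) y = dotp x z) <->
        (dom D y /\ D y = z)].

Definition is_resolvent (D : operator) (l : R[i]) (S : H -> H) : Prop :=
  (forall x, dom D (S x) /\ D (S x) - l *: S x = x) /\
  (forall x, dom D x -> S (D x - l *: x) = x).

Definition compact_resolvent (D : operator) : Prop :=
  exists (l : R[i]) (S : H -> H), is_resolvent D l S /\ compact_op S.

Definition comm_op (D : operator) (T : H -> H) (x : H) : H :=
  D (T x) - T (D x).

Record antiunitary := Antiunitary {
  au_fun :> H -> H;
  au_inv : H -> H;
  au_semilinear : forall (c : R[i]) x y,
    au_fun (c *: x + y) = c^* *: au_fun x + au_fun y;
  au_isometry : forall x, `|au_fun x| = `|x|;
  au_funK : cancel au_fun au_inv;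
  au_invK : cancel au_inv au_fun
}.

Definition conj_by (J : antiunitary) (T : H -> H) : H -> H :=
  J \o T \o au_inv J.

Definition conj_operator (J : antiunitary) (D : operator) : operator :=
  Operator [set x | dom D (au_inv J x)] (conj_by J D).

Definition scale_operator (c : R[i]) (D : operator) : operator :=
  Operator (dom D) (fun x => c *: D x).

Record representation (A : invAlgType R) := Representation {
  rep :> A -> H -> H;
  rep_bounded : forall a, bounded_op (rep a);
  repD : forall a b x, rep (a + b) x = rep a x + rep b x;
  repZ : forall c a x, rep (cscale c a) x = c *: rep a x;
  rep1 : forall x, rep 1 x = x;
  repM : forall a b x, rep (a * b) x = rep a (rep b x);
  rep_star : forall a x y, dotp (rep a x) y = dotp x (rep (star a) y)
}.

Lemma conj_byK J S T : conj_by J S = conj_by J T -> S = T.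
Proof.
move=> ST; apply/funext => x; apply: (can_inj (au_funK J)).
by have /(congr1 (@^~ (J x))) := ST; rewrite /conj_by /= au_funK.
Qed.

Lemma conj_by_comp J S T : conj_by J (S \o T) = conj_by J S \o conj_by J T.
Proof. by apply/funext => x; rewrite /conj_by /= au_funK. Qed.

Lemma auD (J : antiunitary) : {morph J : x y / x + y}.
Proof.
by move=> x y; have := au_semilinear J 1 x y; rewrite scale1r rmorph1 scale1r.
Qed.

Lemma au0 (J : antiunitary) : J 0 = 0.
Proof. by apply: (addrI (J 0)); rewrite -auD !addr0. Qed.

Lemma auZ (J : antiunitary) (c : R[i]) x : J (c *: x) = c^* *: J x.
Proof. by have := au_semilinear J c x 0; rewrite au0 !addr0. Qed.

Lemma dotpDl (x y z : H) : dotp (x + y) z = dotp x z + dotp y z.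
Proof. exact: linearDl. Qed.

Lemma dotpDr (x y z : H) : dotp x (y + z) = dotp x y + dotp x z.
Proof. exact: linearDr. Qed.

Lemma dotpZl c (x y : H) : dotp (c *: x) y = c * dotp x y.
Proof. exact: linearZl_LR. Qed.

Lemma dotpZr c (x y : H) : dotp x (c *: y) = c^* * dotp x y.
Proof. exact: linearZr_LR. Qed.

Lemma au_dotp (J : antiunitary) x y : dotp (J x) (J y) = dotp y x.
Proof.
have pol (u v : H) : dotp (J u) (J v) + dotp (J v) (J u) = dotp u v + dotp v u.
  have E (a b : H) : dotp a b + dotp b a =
      dotp (a + b) (a + b) - dotp a a - dotp b b.
    by rewrite dotpDl !dotpDr; ring.
  by rewrite !E -auD !dotp_norm !au_isometry.
have p1 := pol x y; have := pol ('i *: x) y.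
rewrite auZ !(dotpZl, dotpZr) conjCK conjCi => p2.
have {}p2 : dotp (J y) (J x) - dotp (J x) (J y) = dotp x y - dotp y x.
  apply: (mulfI (neq0Ci _)).
  by transitivity (- 'i * dotp (J x) (J y) + 'i * dotp (J y) (J x));
    [ring | rewrite p2; ring].
have : dotp (J x) (J y) *+ 2 = dotp y x *+ 2.
  transitivity ((dotp (J x) (J y) + dotp (J y) (J x)) -
                (dotp (J y) (J x) - dotp (J x) (J y))); first by ring.
  by rewrite p1 p2; ring.
by move/eqP; rewrite eqrMn2r // => /eqP.
Qed.

Lemma dotp_inj (x y : H) : (forall z, dotp z x = dotp z y) -> x = y.
Proof.
move=> xy; apply/eqP; rewrite -subr_eq0 -normr_eq0 -sqrf_eq0 -dotp_norm.
by rewrite linearB /= xy subrr.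
Qed.

Lemma rep_star_inj (A : invAlgType R) (pi : representation A) a b :
  rep pi a = rep pi b -> rep pi (star a) = rep pi (star b).
Proof.
move=> ab; apply/funext => x; apply: dotp_inj => z.
by rewrite -!rep_star ab.
Qed.

End Operators.

Notation "D =op E" := (op_eq D E) (at level 70, no associativity).

(* The algebra of the operators J a J^-1, with (J a J^-1)^* = J a^* J^-1. *)
Section HatAlgebra.
Variables (R : realType) (H : hilbertType R) (A : invAlgType R).
Variables (pi : representation H A) (J : antiunitary H).

Record hat_alg := HatAlg {
  hat_op :> H -> H;
  hat_opP : `[< exists a, hat_op = conj_by J (pi a) >]
}.
HB.instance Definition _ := [isSub for hat_op].
HB.instance Definition _ := [Choice of hat_alg by <:].

Lemma hat_proof a : `[< exists b, conj_by J (pi a) = conj_by J (pi b) >].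
Proof. by apply/asboolP; exists a. Qed.

Definition hat (a : A) : hat_alg := HatAlg (hat_proof a).

Lemma hat_surj (T : hat_alg) : exists a, T = hat a.
Proof.
by case: (T) => f fP; case/asboolP: (fP) => a fa; exists a; apply: val_inj.
Qed.

Definition unhat (T : hat_alg) : A := projT1 (cid (hat_surj T)).

Lemma unhatK T : hat (unhat T) = T.
Proof. by rewrite /unhat; case: cid. Qed.

Let repDD a b : pi (a + b) = (fun x => pi a x + pi b x).
Proof. by apply/funext => x; rewrite repD. Qed.

Let repZZ c a : pi (cscale c a) = (fun x => c *: pi a x).
Proof. by apply/funext => x; rewrite repZ. Qed.

Let rep0 : pi 0 = (fun=> 0).
Proof.
by apply/funext => x; apply: (addrI (pi 0 x)); rewrite -repD !addr0.
Qed.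

Let repNN a : pi (- a) = (fun x => - pi a x).
Proof.
apply/funext => x; apply: (addrI (pi a x)).
by rewrite -repD !subrr rep0.
Qed.

Let repMM a b : pi (a * b) = pi a \o pi b.
Proof. by apply/funext => x; rewrite repM. Qed.

Let zero := hat 0.
Let add (S T : hat_alg) := hat (unhat S + unhat T).
Let opp (S : hat_alg) := hat (- unhat S).
Let scale (c : R[i]) (S : hat_alg) := hat (cscale c^* (unhat S)).
Let one := hat 1.
Let mul (S T : hat_alg) := hat (unhat S * unhat T).
Let hstar (S : hat_alg) := hat (star (unhat S)).

Let unhatP a : pi (unhat (hat a)) = pi a.
Proof. exact: (@conj_byK _ _ J _ _ (congr1 hat_op (unhatK (hat a)))). Qed.

Let hatP a b : pi a = pi b -> hat a = hat b.
Proof. by move=> ab; apply: val_inj => /=; rewrite ab. Qed.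

Let addE a b : add (hat a) (hat b) = hat (a + b).
Proof. by apply: hatP; rewrite !repDD !unhatP. Qed.
Let oppE a : opp (hat a) = hat (- a).
Proof. by apply: hatP; rewrite !repNN unhatP. Qed.
Let scaleE c a : scale c (hat a) = hat (cscale c^* a).
Proof. by apply: hatP; rewrite !repZZ unhatP. Qed.
Let mulE a b : mul (hat a) (hat b) = hat (a * b).
Proof. by apply: hatP; rewrite !repMM !unhatP. Qed.
Let hstarE a : hstar (hat a) = hat (star a).
Proof. by apply: hatP; apply: rep_star_inj; rewrite unhatP. Qed.

Let addA : associative add.
Proof.
by move=> S T U; rewrite -[S]unhatK -[T]unhatK -[U]unhatK !addE addrA.
Qed.
Let addC : commutative add.
Proof. by move=> S T; rewrite -[S]unhatK -[T]unhatK !addE addrC. Qed.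
Let add0 : left_id zero add.
Proof. by move=> S; rewrite -[S]unhatK addE add0r. Qed.
Let addN : left_inverse zero opp add.
Proof. by move=> S; rewrite -[S]unhatK oppE addE addNr. Qed.
HB.instance Definition _ := GRing.isZmodule.Build hat_alg addA addC add0 addN.

Let mulA : associative mul.
Proof.
by move=> S T U; rewrite -[S]unhatK -[T]unhatK -[U]unhatK !mulE mulrA.
Qed.
Let mul1l : left_id one mul.
Proof. by move=> S; rewrite -[S]unhatK mulE mul1r. Qed.
Let mul1r : right_id one mul.
Proof. by move=> S; rewrite -[S]unhatK mulE mulr1. Qed.
Let mulDl : left_distributive mul +%R.
Proof.
move=> S T U; rewrite -[S]unhatK -[T]unhatK -[U]unhatK.
by rewrite ![_ + _]addE !mulE [RHS]addE mulrDl.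
Qed.
Let mulDr : right_distributive mul +%R.
Proof.
move=> S T U; rewrite -[S]unhatK -[T]unhatK -[U]unhatK.
by rewrite ![_ + _]addE !mulE [RHS]addE mulrDr.
Qed.
HB.instance Definition _ :=
  GRing.Zmodule_isPzRing.Build hat_alg mulA mul1l mul1r mulDl mulDr.

Let scaleA c d S : scale c (scale d S) = scale (c * d) S.
Proof. by rewrite -[S]unhatK !scaleE cscaleA rmorphM. Qed.
Let scale1 S : scale 1 S = S.
Proof. by rewrite -[S]unhatK scaleE rmorph1 cscale1. Qed.
Let scaleDr c : {morph scale c : S T / S + T}.
Proof.
move=> S T; rewrite -[S]unhatK -[T]unhatK.
by rewrite ![_ + _]addE !scaleE [RHS]addE cscaleDr.
Qed.
Let scaleDl S : {morph scale^~ S : c d / c + d}.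
Proof.
move=> c d /=; rewrite -[S]unhatK !scaleE [RHS]addE.
by rewrite rmorphD cscaleDl.
Qed.

Let hscaleAl (c : R[i]) (S T : hat_alg) : scale c (S * T) = scale c S * T.
Proof.
rewrite -[S]unhatK -[T]unhatK [_ * _]mulE !scaleE.
by rewrite [RHS]mulE cscaleAl.
Qed.
Let hscaleAr (c : R[i]) (S T : hat_alg) : scale c (S * T) = S * scale c T.
Proof.
rewrite -[S]unhatK -[T]unhatK [_ * _]mulE !scaleE.
by rewrite [RHS]mulE cscaleAr.
Qed.
Let hstarK : involutive hstar.
Proof. by move=> S; rewrite -[S]unhatK !hstarE starK. Qed.
Let hstarD : {morph hstar : S T / S + T}.
Proof.
move=> S T; rewrite -[S]unhatK -[T]unhatK [X in hstar X]addE !hstarE.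
by rewrite [RHS]addE starD.
Qed.
Let hstarZ (c : R[i]) (S : hat_alg) : hstar (scale c S) = scale c^* (hstar S).
Proof.
by rewrite -[S]unhatK scaleE !hstarE scaleE starZ.
Qed.
Let hstarM (S T : hat_alg) : hstar (S * T) = hstar T * hstar S.
Proof.
rewrite -[S]unhatK -[T]unhatK [X in hstar X]mulE !hstarE.
by rewrite [RHS]mulE starM.
Qed.
HB.instance Definition _ := isInvolutiveAlgebra.Build R hat_alg
  scaleA scale1 scaleDr scaleDl
  hscaleAl hscaleAr hstarK hstarD hstarZ hstarM.

(* The operations of hat_alg are those of operators. *)
Lemma hat_opD (S T : hat_alg) x : (S + T) x = S x + T x.
Proof.
rewrite -[S]unhatK -[T]unhatK [_ + _]addE /= /conj_by /= repDD.
by rewrite auD.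
Qed.
Lemma hat_opM (S T : hat_alg) x : (S * T) x = S (T x).
Proof.
rewrite -[S]unhatK -[T]unhatK [_ * _]mulE /= repMM.
by rewrite conj_by_comp.
Qed.
Lemma hat_opZ (c : R[i]) (S : hat_alg) x : (cscale c S) x = c *: S x.
Proof.
rewrite -[S]unhatK [cscale _ _]scaleE /= /conj_by /= repZZ.
by rewrite auZ conjCK.
Qed.
Lemma hat_op1 x : (1 : hat_alg) x = x.
Proof. by rewrite /= /conj_by /= rep1 au_invK. Qed.

Lemma hat_adjoint (T : hat_alg) x y : dotp (T x) y = dotp x (star T y).
Proof.
rewrite -[T]unhatK [star _]hstarE /= /conj_by /=.
rewrite -{1}[y](au_invK J) au_dotp -{2}[x](au_invK J) au_dotp.
by rewrite rep_star starK.
Qed.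

Lemma hatD : {morph hat : a b / a + b}.
Proof. by move=> a b; rewrite [RHS]addE. Qed.
Lemma hatM : {morph hat : a b / a * b}.
Proof. by move=> a b; rewrite [RHS]mulE. Qed.
Lemma hatZ c a : hat (cscale c a) = cscale c^* (hat a).
Proof. by rewrite [RHS]scaleE conjCK. Qed.
Lemma hat1 : hat 1 = 1.
Proof. by []. Qed.
Lemma hat_star a : hat (star a) = star (hat a).
Proof. by rewrite [RHS]hstarE. Qed.

End HatAlgebra.

Section SpectralTriples.
Variables (R : realType) (H : hilbertType R).

Record spectral_triple (A : invAlgType R) (pi : representation H A)
    (D : operator H) : Prop := SpectralTriple {
  st_self_adjoint : self_adjoint D;
  st_compact_resolvent : compact_resolvent D;
  st_dom : forall a x, dom D x -> dom D (pi a x);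
  st_comm_bounded : forall a, exists M : R[i], forall x, dom D x ->
    `|comm_op D (pi a) x| <= M * `|x|
}.

Record real_spectral_triple (A : invAlgType R) (pi : representation H A)
    (D : operator H) (J : antiunitary H) : Prop := RealSpectralTriple {
  rst_triple : spectral_triple pi D;
  rst_square : exists s : bool, forall x, J (J x) = (-1) ^+ s *: x;
  rst_sign : exists s : bool,
    conj_operator J D =op scale_operator ((-1) ^+ s) D;
  rst_order0 : forall a b x,
    pi a (conj_by J (pi b) x) = conj_by J (pi b) (pi a x)
}.

(* D + sum_i x_i [D, y_i], on the domain of D *)
Definition inner_fluctuation (B : invAlgType R) (rho : B -> H -> H)
    (D : operator H) (X : tensor B B^c) : operator H :=
  Operator (dom D) (fun v =>
    D v + tlift (fun (x : B) (y : B^c) =>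
                   rho x (comm_op D (rho (y : B)) v)) X).

Lemma comm_op_balanced (A : invAlgType R) (pi : representation H A)
    (D : operator H) v : spectral_triple pi D -> dom D v ->
  balanced (fun (x : A) (y : A^c) => pi x (comm_op D (pi (y : A)) v)).
Proof.
move=> [[[_ Dlin] _ _] _ Ddom _] Dv.
have piD a : {morph pi a : x y / x + y}.
  by move=> x y; have [/(_ 1 x y) + _] := rep_bounded pi a; rewrite !scale1r.
have pi0 a : pi a 0 = 0 by apply: (addrI (pi a 0)); rewrite -piD !addr0.
have piZ a c x : pi a (c *: x) = c *: pi a x.
  by have [/(_ c x 0) + _] := rep_bounded pi a; rewrite pi0 !addr0.
have D0 x : dom D x -> D 0 = 0.
  by move=> Dx; have [_] := Dlin (-1) x x Dx Dx; rewrite !scaleN1r !addNr.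
have DZ c x : dom D x -> D (c *: x) = c *: D x.
  move=> Dx; have d0 : dom D 0.
    by have [] := Dlin (-1) x x Dx Dx; rewrite scaleN1r addNr.
  by have [_] := Dlin c x 0 Dx d0; rewrite (D0 x) // !addr0.
split=> [b a a'|a b b'|c a b] /=.
- exact: repD.
- rewrite -piD; congr (pi a _); rewrite /comm_op !repD.
  have [_] := Dlin 1 _ _ (Ddom b v Dv) (Ddom b' v Dv).
  by rewrite !scale1r => ->; rewrite opprD addrACA.
- rewrite repZ -piZ; congr (pi a _); rewrite /comm_op !repZ.
  by rewrite DZ ?scalerBr //; exact: Ddom.
Qed.

Lemma inner_fluctuation_sum (A : invAlgType R) (pi : representation H A)
    (D : operator H) (s : seq (A * A^c)) v : spectral_triple pi D -> dom D v ->
  inner_fluctuation pi D (\sum_(p <- s) tens p.1 p.2) v =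
  D v + \sum_(p <- s) pi p.1 (comm_op D (pi (p.2 : A)) v).
Proof.
by move=> sD Dv; rewrite /= tlift_sum //; exact: comm_op_balanced.
Qed.

Section Real.
Variables (A : invAlgType R) (pi : representation H A) (J : antiunitary H).

(* D + sum_{i,j} a_i ^a_j [D, b_i ^b_j], on the domain of D *)
Definition real_fluctuation (D : operator H) (X : tensor A A^c) : operator H :=
  Operator (dom D) (fun v =>
    D v + tlift (fun (a : A) (b : A^c) =>
      tlift (fun (a' : A) (b' : A^c) =>
        pi a (conj_by J (pi a')
          (comm_op D (pi (b : A) \o conj_by J (pi (b' : A))) v))) X) X).

Definition AhatA : invAlgType R := tensor A (hat_alg pi J).

Definition AhatA_act (T : AhatA) (v : H) : H :=
  tlift (fun (a : A) (b : hat_alg pi J) => pi a (b v)) T.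

Definition hat_tensor (X : tensor A A^c) :
    tensor (hat_alg pi J) (hat_alg pi J)^c :=
  tlift (fun (a : A) (b : A^c) =>
    tens (hat pi J a) (hat pi J (b : A) : (hat_alg pi J)^c)) X.

Definition mu (X : tensor A A^c) : tensor AhatA AhatA^c :=
  tlift (fun (a : A) (b : A^c) =>
    tlift (fun (a' : hat_alg pi J) (b' : (hat_alg pi J)^c) =>
      tens (tens a a' : AhatA)
           ((tens (b : A) (b' : hat_alg pi J) : AhatA) : AhatA^c))
      (hat_tensor X)) X.

End Real.

End SpectralTriples.

Arguments AhatA_act {R H A} pi J T v.

Section MuSum.
Variables (R : realType) (H : hilbertType R).
Variables (A : invAlgType R) (pi : representation H A) (J : antiunitary H).

Lemma hat_tensor_balanced : balanced (fun (a : A) (b : A^c) =>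
  tens (hat pi J a) (hat pi J (b : A) : (hat_alg pi J)^c)).
Proof.
split=> [b a a'|a b b'|c a b] /=.
- by rewrite hatD tensDl.
- by rewrite (@hatD R H A pi J) -tensDr.
- by rewrite !hatZ -scale_tens; symmetry; exact: tensZr.
Qed.

Lemma mu_sum (s : seq (A * A^c)) :
  mu pi J (\sum_(p <- s) tens p.1 p.2) = \sum_(p <- s) \sum_(q <- s)
    tens (tens p.1 (hat pi J q.1) : AhatA pi J)
         ((tens (p.2 : A) (hat pi J (q.2 : A)) : AhatA pi J) : (AhatA pi J)^c).
Proof.
have bin (a : A) (b : A^c) : balanced
    (fun (a' : hat_alg pi J) (b' : (hat_alg pi J)^c) =>
      tens (tens a a' : AhatA pi J)
        ((tens (b : A) (b' : hat_alg pi J) : AhatA pi J) : (AhatA pi J)^c)).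
  split=> [y x x'|x y y'|c x y] /=.
  - by rewrite tensDr tensDl.
  - by rewrite -tensDr; congr tens; exact: tensDr.
  - by rewrite tensZr -scale_tens -tensZr; congr tens; symmetry; exact: tensZr.
have bout : balanced (fun (a : A) (b : A^c) =>
    tlift (fun (a' : hat_alg pi J) (b' : (hat_alg pi J)^c) =>
      tens (tens a a' : AhatA pi J)
        ((tens (b : A) (b' : hat_alg pi J) : AhatA pi J) : (AhatA pi J)^c))
    (hat_tensor pi J (\sum_(p <- s) tens p.1 p.2))).
  split=> [b a a'|a b b'|c a b] /=; rewrite /tlift -?big_split /=;
    apply: eq_bigr => p _.
  - by rewrite !tensDl.
  - by rewrite -tensDr; congr tens; exact: tensDl.
  - by rewrite -scale_tens -scale_tens -tensZr; congr tens; exact: scale_tens.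
rewrite /mu tlift_sum //; apply: eq_bigr => p _.
rewrite /hat_tensor tlift_sum; last exact: hat_tensor_balanced.
elim: (s) => [|q s' IH]; first by rewrite !big_nil tlift0.
by rewrite !big_cons tliftD // IH tlift_tens.
Qed.

End MuSum.

(* Main.v *)
Require Import Defs.
From mathcomp Require Import all_boot all_order all_algebra complex.
From mathcomp Require Import classical_sets reals.
From mathcomp Require Import sesquilinear boolp functions topology normedtype.
From mathcomp Require Import ring.

(* For normalized X = sum a_i (x) b_i the fluctuation of D by X is
   sum a_i D b_i, so composing fluctuations multiplies the elements, and the
   fluctuation is symmetric when X is self-adjoint. It differs from D by a
   bounded symmetric operator B on Dom D. Given a resolvent of D at a non-real
   point l, the resolvents of D + (k/n) B at l exist by Neumann series for
   k = 0, ..., n, since symmetry bounds each of them by 1/|Im l|; they stay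
   compact. Self-adjointness of D + B follows because the adjoint of B is
   defined everywhere, Dom D being dense.
   For (iii), A (x) JAJ^-1 acts on H by an involutive representation, D is a
   spectral triple for it, and the real fluctuation by X is the ordinary one by
   mu X; conjugation by J exchanges the two factors of the tensor product. *)

Set Implicit Arguments.
Unset Strict Implicit.
Unset Printing Implicit Defensive.

Import Order.TTheory GRing.Theory Num.Theory.
Import numFieldNormedType.Exports.

Local Open Scope classical_set_scope.
Local Open Scope ring_scope.

(** * Products of tensors as double sums over representatives *)

Section TensorProducts.
Variables (R : realType) (A B : invAlgType R).

Lemma tlift_bigsum (I : Type) (r : seq I) (F : I -> tensor A B)
    (V : zmodType) (f : A -> B -> V) : balanced f ->
  tlift f (\sum_(i <- r) F i) = \sum_(i <- r) tlift f (F i).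
Proof.
move=> bf; elim: r => [|i r IH]; first by rewrite !big_nil tlift0.
by rewrite !big_cons tliftD // IH.
Qed.

Lemma tensorM (X Y : tensor A B) :
  X * Y = \sum_(p <- repr X) \sum_(q <- repr Y)
            tens (p.1 * q.1) (p.2 * q.2).
Proof.
rewrite {1}[X]tensorE {1}[Y]tensorE mulr_suml; apply: eq_bigr => p _.
by rewrite mulr_sumr; apply: eq_bigr => q _; exact: mul_tens.
Qed.

Lemma tlift_mul (X Y : tensor A B) (V : zmodType) (f : A -> B -> V) :
  balanced f ->
  tlift f (X * Y) = \sum_(p <- repr X) \sum_(q <- repr Y)
                       f (p.1 * q.1) (p.2 * q.2).
Proof.
move=> bf; rewrite tensorM tlift_bigsum //; apply: eq_bigr => p _.
by rewrite tlift_bigsum //; apply: eq_bigr => q _; exact: tlift_tens.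
Qed.

End TensorProducts.

(** * The semi-group of normalized self-adjoint elements *)

Section PertMonoid.
Variables (R : realType) (A : invAlgType R).
Implicit Types X Y : tensor A A^c.

Lemma swap_starE X :
  swap_star X = \sum_(p <- repr X) tens (star (p.2 : A)) (star p.1 : A^c).
Proof. by []. Qed.

(** Multiplicative rather than antimultiplicative: [star] reverses products, and so does moving each
    factor between [A] and [A^c]. *)
Lemma swap_starM X Y : swap_star (X * Y) = swap_star X * swap_star Y.
Proof.
rewrite {1}/swap_star tlift_mul; last exact: swap_star_balanced.
rewrite !swap_starE mulr_suml; apply: eq_bigr => p _.
rewrite mulr_sumr; apply: eq_bigr => q _; rewrite mul_tens.
by congr tens; exact: (@starM R A).
Qed.

(** Second components multiply in reverse order, so the whole sum a_q b_q of [Y] is nested between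
    a_p and b_p; when [Y] is normalized it collapses to 1. *)
Lemma tmulM X Y :
  tmul (X * Y) = \sum_(p <- repr X) p.1 * tmul Y * (p.2 : A).
Proof.
rewrite {1}/tmul tlift_mul; last exact: tmul_balanced.
apply: eq_bigr => p _; rewrite mulr_sumr mulr_suml.
by apply: eq_bigr => q _; rewrite -!mulrA.
Qed.

Lemma Pert1 : Pert A 1.
Proof.
split.
  rewrite /normalized tensor1E /tmul tlift_tens; last exact: tmul_balanced.
  exact: mulr1.
rewrite /selfadjoint_elt tensor1E /swap_star tlift_tens; last first.
  exact: swap_star_balanced.
by congr tens; exact: star1.
Qed.

Lemma PertM X Y : Pert A X -> Pert A Y -> Pert A (X * Y).
Proof.
move=> [nX sX] [nY sY]; split; last first.
  by rewrite /selfadjoint_elt swap_starM sX sY.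
rewrite /normalized tmulM nY -[RHS]nX.
by apply: eq_bigr => p _; rewrite mulr1.
Qed.

End PertMonoid.

(** * Archimedean estimates in [R[i]], where norms take their values, and geometric convergence *)

Section ComplexArchimedean.
Variable R : realType.

Lemma complex_archi (c : R[i]) : c \is Num.real -> exists n, c < n%:R.
Proof.
case/complex_realP => k ->; exists (Num.truncn k).+1.
by rewrite -(rmorph_nat (real_complex R)) ltcR truncnS_gt.
Qed.

Lemma exp2V_small (C e : R[i]) : 0 <= C -> 0 < e ->
  exists n, C * 2^-1 ^+ n < e.
Proof.
move=> C0 e0; have : C / e \is Num.real.
  by rewrite realE divr_ge0 // ltW.
case/complex_archi => n; rewrite ltr_pdivrMr // => Cn; exists n.
have p0 : 0 < (2 : R[i]) ^+ n by rewrite exprn_gt0.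
rewrite exprVn ltr_pdivrMr //; apply: lt_le_trans Cn _.
by rewrite mulrC ler_pM2l // -natrX ler_nat ltnW // ltn_expl.
Qed.

Lemma norm_exp2V_eq0 (V : normedModType R[i]) (a : V) (C : R[i]) :
  0 <= C -> (forall n, `|a| <= C * 2^-1 ^+ n) -> a = 0.
Proof.
move=> C0 aC; apply/eqP; apply: contraT; rewrite -normr_gt0 => a0.
have [n Cn] := exp2V_small C0 a0.
by have := le_lt_trans (aC n) Cn; rewrite ltxx.
Qed.

Lemma geometric_cvg (V : completeNormedModType R[i]) (u : nat -> V)
    (C : R[i]) : 0 <= C ->
  (forall n, `|u n.+1 - u n| <= C * 2^-1 ^+ n) ->
  exists l, forall n, `|l - u n| <= (C *+ 2) * 2^-1 ^+ n.
Proof.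
move=> C0 uC.
(* The bound is the exact partial sum of the geometric series, so the induction on [m] closes with
   an equality. *)
have uD n m : `|u (n + m)%N - u n| <=
    (C *+ 2) * (2^-1 ^+ n - 2^-1 ^+ (n + m)).
  elim: m => [|m IH]; first by rewrite addn0 !subrr mulr0 normr0.
  rewrite -(subrKA (u (n + m)%N)); apply: le_trans (ler_normD _ _) _.
  rewrite addnS; apply: le_trans (lerD (uC _) IH) _.
  rewrite le_eqVlt; apply/orP; left; apply/eqP.
  by rewrite exprS; field.
have uD' n m : (n <= m)%N -> `|u m - u n| <= (C *+ 2) * 2^-1 ^+ n.
  move=> /subnKC <-; apply: le_trans (uD _ _) _.
  by rewrite ler_wpM2l ?mulrn_wge0 // gerBl exprn_ge0 // invr_ge0.
have : cvg (u @ \oo).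
  apply: cauchy_cvg; apply: cauchy_exP => e e0.
  have [N Ne] := exp2V_small (mulrn_wge0 2 C0) e0.
  exists (u N); exists N => // m Nm; rewrite -ball_normE /= distrC.
  exact: le_lt_trans (uD' _ _ Nm) Ne.
move=> /cvg_ex [l ul]; exists l => n; apply/ler_addgt0Pl => e e0.
move/cvgrPdist_lt: ul => /(_ e e0) [N _ Nu].
have := Nu (N + n)%N (leq_addr _ _); move=> /= lu.
rewrite -(subrKA (u (N + n)%N)); apply: le_trans (ler_normD _ _) _.
by rewrite lerD ?(ltW lu) // uD' // leq_addl.
Qed.

End ComplexArchimedean.

(** * Linear, bounded and compact operators *)

Section CompactOperators.
Variables (R : realType) (H : hilbertType R).

Lemma linear_additive (T : H -> H) : linear T -> {morph T : x y / x + y}.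
Proof. by move=> lT x y; have := lT 1 x y; rewrite !scale1r. Qed.

Lemma linear_at0 (T : H -> H) : linear T -> T 0 = 0.
Proof.
by move=> lT; apply: (addrI (T 0)); rewrite -(linear_additive lT) !addr0.
Qed.

Lemma linear_scalable (T : H -> H) c x : linear T -> T (c *: x) = c *: T x.
Proof. by move=> lT; have := lT c x 0; rewrite (linear_at0 lT) !addr0. Qed.

Lemma linear_subr (T : H -> H) : linear T -> {morph T : x y / x - y}.
Proof.
by move=> lT x y; rewrite -scaleN1r addrC lT scaleN1r addrC.
Qed.

(** [M] is any element of [R[i]]; the right-hand side dominates a norm, hence is its own modulus. *)
Lemma bound_normr (u x : H) (M : R[i]) :
  `|u| <= M * `|x| -> `|u| <= `|M| * `|x|.
Proof.
move=> ux.
by rewrite -[`|x|]normr_id -normrM (ger0_norm (le_trans (normr_ge0 _) ux)).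
Qed.

Lemma compact_op_comp (S T : H -> H) (C : R[i]) :
  compact_op S -> linear T -> (forall x, `|T x| <= C * `|x|) ->
  compact_op (S \o T).
Proof.
move=> [lS cS] lT bT; split=> [c x y /=|]; first by rewrite lT lS.
set K := closure _ in cS.
have C0 : 0 < `|C| + 1 :> R[i] by rewrite ltr_wpDl.
(* [T] sends the unit ball into the ball of radius [|C| + 1], so the image under [S \o T] lies in
   this dilate of [K]. Adding 1 makes the factor invertible. *)
pose Z := ( *:%R (`|C| + 1) : H -> H) @` K.
have cZ : compact Z.
  apply: continuous_compact => //; apply: continuous_subspaceT => x.
  exact: scaler_continuous.
apply: (subclosed_compact _ cZ); first exact: closed_closure.
have clZ : closed Z by apply: compact_closed => //; exact: norm_hausdorff.
rewrite (closure_id Z).1 //; apply: closureS => _ [x /= x1 <-].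
exists (S ((`|C| + 1)^-1 *: T x)); last first.
  by rewrite (linear_scalable _ _ lS) scalerA divff ?scale1r // gt_eqF.
apply: subset_closure; exists ((`|C| + 1)^-1 *: T x) => //=.
rewrite normrZ normfV gtr0_norm // ler_pdivrMl // mulr1.
apply: le_trans (bound_normr (bT x)) _.
apply: le_trans (_ : `|C| <= _); first by rewrite ler_piMr.
by rewrite lerDl.
Qed.

Lemma compact_op_bounded (S : H -> H) : compact_op S -> bounded_op S.
Proof.
move=> [lS cS]; split=> //.
have [n nK] : exists n : nat, forall y, closure (S @` [set x | `|x| <= 1]) y ->
    `|y| <= n%:R.
  (* Compactness turns local bounds into a uniform one: if [|x| < n], every [m > n] bounds the norm
     on the unit ball around [x]. *)
  have [|N _ NP] := (compact_near_coveringP _).1 cS nat \oo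
      (fun n y => `|y| <= n%:R) _.
    move=> x _; have [n xn] := complex_archi (normr_real x).
    exists (ball x 1, [set m | n < m]%N).
      by split; [exact: nbhsx_ballx | exists n.+1].
    move=> [y m] /= [+ nm]; rewrite -ball_normE /= => xy.
    rewrite -(subrK x y); apply: le_trans (ler_normD _ _) _.
    rewrite -[m](subnK nm) addnS -addn1 natrD addrC lerD //; last first.
      by rewrite distrC ltW.
    by rewrite ltW // (lt_le_trans xn) // ler_nat leq_addl.
  by exists N => y Ky; exact: (NP N (leqnn N)).
exists n%:R => x; have [->|x0] := eqVneq x 0.
  by rewrite (linear_at0 lS) !normr0 mulr0.
have nx0 : 0 < `|x| by rewrite normr_gt0.
have -> : S x = `|x| *: S (`|x|^-1 *: x).
  by rewrite (linear_scalable _ _ lS) scalerA divff ?scale1r // gt_eqF.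
rewrite normrZ normr_id mulrC ler_pM2r //; apply: nK.
apply: subset_closure; exists (`|x|^-1 *: x) => //=.
by rewrite normrZ normfV normr_id mulVf // gt_eqF.
Qed.

End CompactOperators.

(** * The Cauchy-Schwarz inequality *)

Section InnerProduct.
Variables (R : realType) (H : hilbertType R).
Implicit Types x y : H.

Lemma dotpC x y : dotp x y = (dotp y x)^*.
Proof. by rewrite [LHS]hermC /= expr0 mul1r. Qed.

Lemma dotpBl x y z : dotp (x - y) z = dotp x z - dotp y z.
Proof. exact: linearBl. Qed.

Lemma dotpBr x y z : dotp x (y - z) = dotp x y - dotp x z.
Proof. exact: linearBr. Qed.

(** Expand the nonnegative square norm of [|y|^2 x - <x,y> y], a multiple of the component of [x]
    orthogonal to [y] that needs no division. *)
Lemma dotp_le x y : `|dotp x y| <= `|x| * `|y|.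
Proof.
have [->|y0] := eqVneq y 0.
  by rewrite linear0r !normr0 mulr0.
have ny0 : 0 < `|y| ^+ 2 by rewrite exprn_gt0 // normr_gt0.
have n2C : (`|y| ^+ 2)^* = `|y| ^+ 2 by rewrite geC0_conj // ltW.
set z := dotp x y.
have : 0 <= dotp (`|y| ^+ 2 *: x - z *: y) (`|y| ^+ 2 *: x - z *: y).
  by rewrite dotp_norm exprn_ge0.
have -> : dotp (`|y| ^+ 2 *: x - z *: y) (`|y| ^+ 2 *: x - z *: y) =
    `|y| ^+ 2 * ((`|x| * `|y|) ^+ 2 - `|z| ^+ 2).
  rewrite dotpBl !dotpBr !dotpZl !dotpZr !dotp_norm (dotpC y x) -/z n2C normCK.
  by ring.
by rewrite pmulr_rge0 // subr_ge0 ler_sqr ?nnegrE ?mulr_ge0.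
Qed.
End InnerProduct.

(** * Neumann series and resolvents of symmetric operators *)

Section BoundedPerturbation.
Variables (R : realType) (H : hilbertType R).

(** [1 + K] is bounded below, hence injective; iterating u := x - K u converges geometrically to a
    preimage of x. Injectivity makes the chosen inverse linear. *)
Lemma neumann_inverse (K : H -> H) : linear K ->
  (forall x, `|K x| <= 2^-1 * `|x|) ->
  exists T, [/\ linear T, forall x, T x + K (T x) = x,
    forall x, T (x + K x) = x & forall x, `|T x| <= 2 * `|x|].
Proof.
move=> lK bK.
have bnd u : `|u| <= 2 * `|u + K u|.
  have : `|u| <= `|u + K u| + 2^-1 * `|u|.
    rewrite -{1}(addrK (K u) u); apply: le_trans (ler_normB _ _) _.
    by rewrite lerD2l.
  rewrite -lerBlDr -{1}[`|u|]mul1r -mulrBl.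
  have -> : 1 - 2^-1 = 2^-1 :> R[i] by field.
  by rewrite ler_pdivrMl.
have inj u v : u + K u = v + K v -> u = v.
  move=> uv; apply/eqP; rewrite -subr_eq0 -normr_le0.
  apply: le_trans (bnd _) _.
  by rewrite (linear_subr lK) addrACA -opprD uv subrr normr0 mulr0.
have sol x : exists u, u + K u = x.
  pose u := fix u n := if n is n'.+1 then x - K (u n') else 0.
  have uS n : `|u n.+1 - u n| <= `|x| * 2^-1 ^+ n.
    elim: n => [|n IH].
      by rewrite /= (linear_at0 lK) !subr0 expr0 mulr1.
    have -> : u n.+2 - u n.+1 = K (u n - u n.+1).
      by rewrite (linear_subr lK) /= opprB addrC subrKA.
    apply: le_trans (bK _) _; rewrite distrC exprS mulrCA.
    by rewrite ler_wpM2l // invr_ge0.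
  have [l ul] := geometric_cvg (normr_ge0 x) uS.
  exists l; apply/eqP; rewrite -subr_eq0; apply/eqP.
  apply: (@norm_exp2V_eq0 _ _ _ (`|x| *+ 2)) => [|n].
    by rewrite mulrn_wge0.
  (* The recursion replaces [x] by [u n.+1 + K (u n)], so the residual of the limit is a sum of two
     approximation errors. *)
  have -> : l + K l - x = (l - u n.+1) + K (l - u n).
    rewrite (linear_subr lK) /= opprB [RHS]addrACA; congr (_ + _).
    by rewrite addrAC subrr add0r.
  apply: le_trans (ler_normD _ _) _.
  apply: le_trans (lerD (ul _) (le_trans (bK _) (ler_wpM2l _ (ul n)))) _.
    by rewrite invr_ge0.
  by rewrite le_eqVlt; apply/orP; left; apply/eqP; rewrite exprS; field.
have [T TK] := choice sol; exists T; split=> [c x y|x|x|x] //.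
- by apply: inj; rewrite TK lK addrACA -scalerDr !TK.
- by apply: inj; rewrite TK.
- by apply: le_trans (bnd _) _; rewrite TK.
Qed.

(** On the domain, E + P - l = (1 + P S)(E - l), so the new resolvent is [S] after the Neumann
    inverse of [1 + P S]. *)
Lemma perturb_resolvent (E E' : operator H) (P : H -> H) l S :
  is_resolvent E l S -> compact_op S -> linear (P \o S) ->
  (forall x, `|P (S x)| <= 2^-1 * `|x|) ->
  dom E' = dom E -> (forall x, dom E x -> E' x = E x + P x) ->
  exists S', is_resolvent E' l S' /\ compact_op S'.
Proof.
move=> [RS SR] cS lPS bPS dE E'E.
have [T [lT TK KT bT]] := neumann_inverse lPS bPS.
exists (S \o T); split; last exact: compact_op_comp cS lT bT.
split=> [x|x] /=.
  have [dS ES] := RS (T x); rewrite dE E'E //; split=> //.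
  by rewrite addrAC ES; exact: TK.
rewrite dE => dx; rewrite E'E // addrAC.
by have := KT (E x - l *: x); rewrite /= SR // => ->; exact: SR.
Qed.

Definition symmetric_operator (E : operator H) : Prop :=
  forall x y, dom E x -> dom E y -> dotp (E x) y = dotp x (E y).

(** Since <E x, x> is real, the imaginary part of <(E - l) x, x> comes from [l] alone;
    Cauchy-Schwarz concludes. Here [|l - l^*|] is twice |Im l|. *)
Lemma symmetric_lower_bound (E : operator H) (l : R[i]) x :
  symmetric_operator E -> dom E x ->
  `|l - l^*| * `|x| <= 2 * `|E x - l *: x|.
Proof.
move=> sE dx; have [->|x0] := eqVneq x 0.
  by rewrite normr0 mulr0 mulr_ge0.
rewrite -(@ler_pM2r _ `|x|) ?normr_gt0 // -!mulrA.
set z := dotp (E x - l *: x) x.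
have <- : `|z - z^*| = `|l - l^*| * (`|x| * `|x|).
  have -> : z - z^* = (l^* - l) * `|x| ^+ 2.
    rewrite -dotpC /z dotpBl dotpBr dotpZl dotpZr dotp_norm sE //.
    by ring.
  by rewrite normrM distrC normrX normr_id expr2.
apply: le_trans (ler_normB _ _) _; rewrite norm_conjC mulr_natl mulr2n.
by rewrite lerD // dotp_le.
Qed.

(** The bound of [symmetric_lower_bound] is void at a real point, and [compact_resolvent] may
    provide just such a point. *)
Lemma nonreal_resolvent (E : operator H) :
  symmetric_operator E -> compact_resolvent E ->
  exists l S, [/\ l^* != l, is_resolvent E l S & compact_op S].
Proof.
move=> sE [l [S [RS cS]]].
have [lR|] := eqVneq l^* l; last by exists l, S.
(* A real l is moved off the real axis by less than 1 / norm S. *)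
have [lS [M bM]] := compact_op_bounded cS.
pose t : R[i] := (2 * (`|M| + 1))^-1.
have t0 : 0 < t by rewrite invr_gt0 mulr_gt0 // ltr_wpDl.
have [||x dx|S' [RS' cS']] := @perturb_resolvent E
  (Operator (dom E) (fun x => E x - ('i * t) *: x))
  (fun x => - ('i * t) *: x) l S RS cS _ _ erefl.
- by move=> c x y /=; rewrite lS scalerDr !scalerA mulrC.
- move=> x; rewrite normrZ normrN normrM normCi mul1r gtr0_norm //.
  have bx : `|S x| <= (`|M| + 1) * `|x|.
    apply: le_trans (bound_normr (bM x)) _.
    by rewrite ler_wpM2r // lerDl.
  rewrite (le_trans (ler_wpM2l (ltW t0) bx)) // /t invfM mulrA divfK //.
  by rewrite gt_eqF // ltr_wpDl.
- by rewrite /= scaleNr.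
(* A resolvent of E - it at [l] is a resolvent of [E] at l + it. *)
exists (l + 'i * t), S'; split=> //.
  rewrite rmorphD rmorphM /= lR conjCi (geC0_conj (ltW t0)) -subr_eq0.
  rewrite opprD addrACA subrr add0r mulNr -opprD oppr_eq0 -mulr2n mulrn_eq0 /=.
  by rewrite mulf_neq0 ?neq0Ci // gt_eqF.
case: RS' => R1 R2; split=> [x|x dx].
  have [d e] := R1 x; split=> //; rewrite -[RHS]e /= scalerDl opprD addrA.
  by rewrite addrAC.
by rewrite -[RHS](R2 x dx) /= scalerDl opprD addrA addrAC.
Qed.

End BoundedPerturbation.

(** * Stability of compact resolvent and self-adjointness under bounded symmetric perturbations *)

Section SelfAdjointPerturbation.
Variables (R : realType) (H : hilbertType R).

Lemma self_adjoint_symmetric (D : operator H) :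
  self_adjoint D -> symmetric_operator D.
Proof. by move=> [_ _ aD] x y dx dy; have [_ ->] := aD y (D y). Qed.

Lemma dense_approx (A : set H) : closure A = [set: H] ->
  forall y, exists u : nat -> H, forall n, A (u n) /\ `|y - u n| <= 2^-1 ^+ n.
Proof.
move=> cA y; suff : forall n, exists x, A x /\ `|y - x| <= 2^-1 ^+ n
  by move=> /choice [u uP]; exists u.
move=> n.
have : closure A y by rewrite cA.
have e0 : 0 < 2^-1 ^+ n :> R[i] by rewrite exprn_gt0 // invr_gt0.
move=> /(_ _ (nbhsx_ballx y _ e0)) [x [Ax]]; rewrite -ball_normE /= => yx.
by exists x; split=> //; exact: ltW.
Qed.

(** For [v n] in [A] tending to [u], <u, u> = <u - v n, u> tends to 0. *)
Lemma dotp_dense_eq0 (A : set H) (u : H) : closure A = [set: H] ->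
  (forall x, A x -> dotp x u = 0) -> u = 0.
Proof.
move=> cA uA; have [v vu] := dense_approx cA u.
apply/eqP; rewrite -normr_eq0 -sqrf_eq0 -dotp_norm; apply/eqP.
apply: (@norm_exp2V_eq0 _ R[i]^o _ `|u|) => // n.
have [Av /(ler_wpM2r (normr_ge0 u)) vn] := vu n.
rewrite -[dotp u u]subr0 -(uA _ Av) -dotpBl.
by apply: le_trans (dotp_le _ _) _; rewrite [leRHS]mulrC.
Qed.

Variables (D : operator H) (B : H -> H) (M : R[i]).
Hypothesis D_lin : linear_operator D.
Hypothesis D_sym : symmetric_operator D.
Hypothesis B_lin : forall c x y, dom D x -> dom D y ->
  B (c *: x + y) = c *: B x + B y.
Hypothesis B_sym : forall x y, dom D x -> dom D y ->
  dotp (B x) y = dotp x (B y).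
Hypothesis B_bnd : forall x, dom D x -> `|B x| <= M * `|x|.

Let B_bnd' x : dom D x -> `|B x| <= `|M| * `|x|.
Proof. by move=> /B_bnd /bound_normr. Qed.

Lemma perturb_compact_resolvent : compact_resolvent D ->
  compact_resolvent (Operator (dom D) (fun x => D x + B x)).
Proof.
move=> /(nonreal_resolvent D_sym) [l [S0 [lR RS0 cS0]]].
have d0 : 0 < `|l - l^*| by rewrite normr_gt0 subr_eq0 eq_sym.
(* The resolvents below are bounded by [2 / |l - l^*|], so this [n] makes [B / n] composed with any
   of them bounded by 1/2. *)
have [n] : exists n, 4 * `|M| / `|l - l^*| < n%:R.
  by apply: complex_archi; rewrite realE divr_ge0 // mulr_ge0.
rewrite ltr_pdivrMr // => nM.
have n0 : 0 < n%:R :> R[i].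
  have : 0 < n%:R * `|l - l^*| by apply: le_lt_trans nM; rewrite mulr_ge0.
  by rewrite pmulr_lgt0.
pose E k := Operator (dom D) (fun x => D x + (k%:R / n%:R) *: B x).
have symE k : symmetric_operator (E k).
  move=> x y dx dy; rewrite dotpDl dotpDr D_sym // dotpZl dotpZr B_sym //.
  by rewrite geC0_conj // divr_ge0.
suff /(_ n) [S [[R1 R2] cS]] : forall k, exists S,
    is_resolvent (E k) l S /\ compact_op S.
  exists l, S; split=> //; rewrite /E /= divff ?gt_eqF // in R1 R2.
  by split=> x; [have := R1 x|have := R2 x]; rewrite /= scale1r.
elim=> [|k [S [RS cS]]].
  exists S0; split=> //; case: RS0 => R1 R2.
  by split=> x; [have := R1 x|have := R2 x]; rewrite /= mul0r scale0r addr0.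
have dS x : dom D (S x) by case: RS => /(_ x) [].
(* Symmetry of [E k] makes the bound independent of [k], so one step size serves the whole
   induction. *)
have bS x : `|l - l^*| * `|S x| <= 2 * `|x|.
  have := symmetric_lower_bound l (symE k) (dS x).
  by case: RS => /(_ x) [_ ->].
apply: (@perturb_resolvent _ _ (E k) _ (fun x => n%:R^-1 *: B x) l S) => //.
- move=> c x y /=; have [-> _] := cS; rewrite B_lin // scalerDr !scalerA.
  by rewrite mulrC.
- move=> x; rewrite normrZ normfV (gtr0_norm n0) ler_pdivrMl //.
  apply: le_trans (B_bnd' (dS x)) _.
  rewrite -(ler_pM2l d0) mulrCA.
  apply: le_trans (ler_wpM2l (normr_ge0 M) (bS x)) _.
  rewrite [leRHS](_ : _ = n%:R * `|l - l^*| * (2^-1 * `|x|)); last first.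
    by rewrite mulrCA mulrA.
  apply: le_trans (ler_wpM2r _ (ltW nM)); last by rewrite mulr_ge0 // invr_ge0.
  by rewrite le_eqVlt; apply/orP; left; apply/eqP; field.
- by move=> x dx /=; rewrite -addrA -scalerDl -natr1 mulrDl mul1r.
Qed.

Lemma perturb_self_adjoint : self_adjoint D ->
  self_adjoint (Operator (dom D) (fun x => D x + B x)).
Proof.
move=> [_ cD aD]; split=> //=.
  split; first by case: D_lin.
  move=> c x y dx dy; have [d e] := D_lin.2 c x y dx dy; split=> //.
  by rewrite /= e B_lin // scalerDr addrACA.
move=> y z; split=> [yz|[dy <-] x dx]; last first.
  by rewrite dotpDl dotpDr D_sym // B_sym.
(* The value w at y of the adjoint of B is the limit of B (u n), u --> y. *)
have [u uy] := dense_approx cD y.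
have BB a b : dom D a -> dom D b -> B a - B b = B (a - b) /\ dom D (a - b).
  move=> da db; rewrite [a - b]addrC -(scaleN1r b); split.
    by rewrite B_lin // scaleN1r addrC.
  by have [] := D_lin.2 (-1) b a db da.
(* Both [u n] and [u n.+1] are within 2^-n of [y], hence the factor 2. *)
have uS n : `|B (u n.+1) - B (u n)| <= (`|M| *+ 2) * 2^-1 ^+ n.
  have [d1 e1] := uy n; have [d2 e2] := uy n.+1.
  have [-> d] := BB _ _ d2 d1; apply: le_trans (B_bnd' d) _.
  rewrite mulrnAl -mulrnAr ler_wpM2l // -(subrKA y).
  apply: le_trans (ler_normD _ _) _; rewrite mulr2n lerD // distrC.
  apply: le_trans e2 _; rewrite exprS ler_piMl ?exprn_ge0 ?invr_ge0 //.
  by rewrite invf_le1 ?ler1n.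
have [w wu] := geometric_cvg (mulrn_wge0 2 (normr_ge0 M)) uS.
have Bw x : dom D x -> dotp (B x) y = dotp x w.
  move=> dx; apply/eqP; rewrite -subr_eq0; apply/eqP.
  apply: (@norm_exp2V_eq0 _ R[i]^o _
    (`|B x| + `|x| * (`|M| *+ 2 *+ 2))) => [|n].
    by rewrite addr_ge0 // mulr_ge0 // !mulrn_wge0.
  have [du eu] := uy n.
  have -> : dotp (B x) y - dotp x w =
      dotp (B x) (y - u n) - dotp x (w - B (u n)).
    by rewrite !dotpBr (B_sym dx du) opprB addrA subrK.
  apply: le_trans (ler_normB _ _) _; rewrite mulrDl -mulrA.
  by apply: lerD; apply: le_trans (dotp_le _ _) _; exact: ler_wpM2l.
(* Removing [B] from the adjoint relation leaves <D x, y> = <x, z - w>, to which self-adjointness of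
   [D] applies. Density of the domain then identifies [w] with [B y]. *)
have [dy Dy] : dom D y /\ D y = z - w.
  apply/aD => x dx; rewrite dotpBr -yz // dotpDl Bw //.
  by rewrite addrK.
split=> //; rewrite Dy; suff -> : B y = w by rewrite subrK.
apply/eqP; rewrite -subr_eq0; apply/eqP; apply: dotp_dense_eq0 cD _ => x dx.
by rewrite dotpBr -B_sym // Bw // subrr.
Qed.

End SelfAdjointPerturbation.

Lemma tlift_swap_star (R : realType) (A : invAlgType R) (X : tensor A A^c)
    (V : zmodType) (f : A -> A^c -> V) : balanced f ->
  tlift f (swap_star X) =
  \sum_(p <- repr X) f (star (p.2 : A)) (star p.1 : A^c).
Proof.
move=> bf; rewrite swap_starE tlift_bigsum //.
by apply: eq_bigr => p _; exact: tlift_tens.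
Qed.

(** * Finite sums and compositions of maps bounded on a subset *)

Section Bounds.
Variables (R : realType) (H : hilbertType R).

(** Bounds are relative to a set because commutators with [D] are controlled only on its domain. *)
Lemma bounded_on_sum (I : Type) (r : seq I) (F : I -> H -> H) (A : set H) :
  (forall i, exists M : R[i], forall x, A x -> `|F i x| <= M * `|x|) ->
  exists M : R[i], forall x, A x -> `|\sum_(i <- r) F i x| <= M * `|x|.
Proof.
move=> bF; elim: r => [|i r [M bM]].
  by exists 0 => x _; rewrite big_nil normr0 mul0r.
have [N bN] := bF i; exists (N + M) => x Ax; rewrite big_cons mulrDl.
by apply: le_trans (ler_normD _ _) _; rewrite lerD ?bN ?bM.
Qed.

Lemma bounded_on_comp (T F : H -> H) (A : set H) : bounded_op T ->
  (exists M : R[i], forall x, A x -> `|F x| <= M * `|x|) ->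
  exists M : R[i], forall x, A x -> `|T (F x)| <= M * `|x|.
Proof.
move=> [_ [N bN]] [M bM]; exists (`|N| * M) => x Ax; rewrite -mulrA.
by apply: le_trans (bound_normr (bN _)) _; rewrite ler_wpM2l // bM.
Qed.

Lemma linear_operator_at0 (D : operator H) : linear_operator D -> D 0 = 0.
Proof.
move=> [D0 DL]; have [_] := DL 1 0 0 D0 D0; rewrite !scale1r addr0 => D00.
by apply: (addrI (D 0)); rewrite addr0 -D00.
Qed.

Lemma linear_operator_sum (D : operator H) (I : Type) (r : seq I) (F : I -> H) :
  linear_operator D -> (forall i, dom D (F i)) ->
  dom D (\sum_(i <- r) F i) /\
  D (\sum_(i <- r) F i) = \sum_(i <- r) D (F i).
Proof.
move=> lD dF; have [D0 DL] := lD; have Dz := linear_operator_at0 lD.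
elim: r => [|i r [d e]]; first by rewrite !big_nil.
by have [] := DL 1 _ _ (dF i) d; rewrite !big_cons !scale1r e.
Qed.

End Bounds.

(** * Inner fluctuations of ordinary spectral triples *)

Section InnerFluctuation.
Variables (R : realType) (H : hilbertType R) (A : invAlgType R).
Variable pi : representation H A.
Implicit Types (D : operator H) (X Y : tensor A A^c) (a b : A).

Lemma rep_linear a : linear (pi a).
Proof. by have [] := rep_bounded pi a. Qed.

Lemma rep_sumr a (I : Type) (r : seq I) (F : I -> H) :
  pi a (\sum_(i <- r) F i) = \sum_(i <- r) pi a (F i).
Proof.
apply: (big_morph (pi a)); first exact: linear_additive (rep_linear a).
exact: linear_at0 (rep_linear a).
Qed.

Lemma rep_suml (I : Type) (r : seq I) (F : I -> A) v :
  pi (\sum_(i <- r) F i) v = \sum_(i <- r) pi (F i) v.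
Proof.
apply: (big_morph (fun a => pi a v)) => [a b|]; first exact: repD.
by apply: (addrI (pi 0 v)); rewrite -repD !addr0.
Qed.

Definition sandwich D v : A -> A^c -> H :=
  fun a b => pi a (D (pi (b : A) v)).

Lemma sandwich_balanced D v : spectral_triple pi D -> dom D v ->
  balanced (sandwich D v).
Proof.
move=> [[lD _ _] _ Ddom _] Dv; rewrite /sandwich.
have [D0 DL] := lD; have Dz := linear_operator_at0 lD.
split=> [b a a'|a b b'|c a b] /=.
- exact: repD.
- rewrite -(linear_additive (rep_linear a)) repD.
  by have [_] := DL 1 _ _ (Ddom b v Dv) (Ddom b' v Dv); rewrite !scale1r => ->.
- rewrite !repZ -(linear_scalable _ _ (rep_linear a)).
  by have [_] := DL c _ _ (Ddom b v Dv) D0; rewrite Dz !addr0 => ->.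
Qed.

(** Normalization writes D v as the sum of a_i b_i D v, which cancels the second half of each a_i
    [D, b_i] v. *)
Lemma inner_fluctuationE D X v : normalized X ->
  inner_fluctuation pi D X v = tlift (sandwich D v) X.
Proof.
move=> nX; rewrite /= -{1}[D v](rep1 pi) -nX /tmul /tlift.
rewrite rep_suml -big_split /=.
apply: eq_bigr => p _; rewrite /comm_op (linear_subr (rep_linear p.1)) repM.
by rewrite addrC subrK.
Qed.

(** Both sides are sums of a_p a_q D b_q b_p with p from [Y] and q from [X]; in [A^c] the product
    b_q b_p is taken in the order p, q, whence [Y * X]. *)
Lemma inner_fluctuation_comp D X Y : spectral_triple pi D ->
  Pert A X -> Pert A Y ->
  inner_fluctuation pi (inner_fluctuation pi D X) Y
    =op inner_fluctuation pi D (Y * X).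
Proof.
move=> sD PX PY; split=> // v Dv.
rewrite (inner_fluctuationE _ _ PY.1) (inner_fluctuationE _ _ (PertM PY PX).1).
rewrite tlift_mul; last exact: sandwich_balanced.
apply: eq_bigr => p _; rewrite /sandwich (inner_fluctuationE _ _ PX.1).
rewrite /tlift rep_sumr; apply: eq_bigr => q _.
by rewrite /sandwich repM; congr (pi _ (pi _ (D _))); symmetry; exact: repM.
Qed.

(** The adjoint of a D b is b^* D a^*, the term of [swap_star X]; so [X] is replaced by
    [swap_star X] on one side only and terms match. *)
Lemma inner_fluctuation_symmetric D X : spectral_triple pi D -> Pert A X ->
  symmetric_operator (inner_fluctuation pi D X).
Proof.
move=> sD [nX sX] x y dx dy; rewrite !inner_fluctuationE //.
rewrite -{2}sX tlift_swap_star; last exact: sandwich_balanced.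
have dom_pi := st_dom sD.
have sumL I (r : seq I) (F : I -> H) z :
    dotp (\sum_(i <- r) F i) z = \sum_(i <- r) dotp (F i) z.
  apply: (big_morph (fun u => dotp u z)) => [u v|]; first exact: dotpDl.
  exact: linear0l.
have sumR I (r : seq I) (F : I -> H) z :
    dotp z (\sum_(i <- r) F i) = \sum_(i <- r) dotp z (F i).
  apply: (big_morph (dotp z)) => [u v|]; first exact: dotpDr.
  exact: linear0r.
rewrite /tlift sumL sumR; apply: eq_bigr => p _; rewrite /sandwich.
rewrite rep_star (self_adjoint_symmetric (st_self_adjoint sD)).
- exact: rep_star.
- exact: dom_pi.
- exact: dom_pi.
Qed.

Lemma inner_fluctuation_triple D X : spectral_triple pi D -> Pert A X ->
  spectral_triple pi (inner_fluctuation pi D X).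
Proof.
move=> sD PX; have [aD cD dD bD] := sD; have [lD _ _] := aD.
pose B v := \sum_(p <- repr X) pi p.1 (comm_op D (pi (p.2 : A)) v).
have [M bB] : exists M : R[i], forall x, dom D x -> `|B x| <= M * `|x|.
  apply: bounded_on_sum => p; apply: bounded_on_comp (bD _).
  exact: rep_bounded.
have lB c x y : dom D x -> dom D y -> B (c *: x + y) = c *: B x + B y.
  move=> dx dy; rewrite /B scaler_sumr -big_split /=; apply: eq_bigr => p _.
  rewrite -(rep_linear p.1); congr (pi _ _); rewrite /comm_op rep_linear.
  have [_ ->] := lD.2 c x y dx dy.
  have [_ ->] := lD.2 c _ _ (dD p.2 _ dx) (dD p.2 _ dy).
  by rewrite rep_linear scalerBr opprD addrACA.
(* [B] is the difference of two symmetric operators, the fluctuation and [D]. *)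
have sB x y : dom D x -> dom D y -> dotp (B x) y = dotp x (B y).
  move=> dx dy; have := inner_fluctuation_symmetric sD PX dx dy.
  rewrite /= dotpDl dotpDr (self_adjoint_symmetric aD) // => /addrI.
  exact.
have sDs := self_adjoint_symmetric aD.
split=> //.
- exact: (perturb_self_adjoint lD sDs lB sB bB aD).
- exact: (perturb_compact_resolvent sDs lB sB bB cD).
- move=> a; have [N bN] := bD a.
  have [P bP] := bounded_on_comp (rep_bounded pi a) (ex_intro _ M bB).
  have [_ [Q bQ]] := rep_bounded pi a.
  exists (N + (`|M| * Q + P)) => x dx.
  have -> : comm_op (inner_fluctuation pi D X) (pi a) x =
      comm_op D (pi a) x + (B (pi a x) - pi a (B x)).
    rewrite /comm_op /= (linear_additive (rep_linear a)) -/(B _) -/(B _).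
    by rewrite opprD addrACA.
  rewrite mulrDl; apply: le_trans (ler_normD _ _) _; rewrite lerD ?bN //.
  rewrite mulrDl; apply: le_trans (ler_normB _ _) _; rewrite lerD ?bP //.
  apply: le_trans (bound_normr (bB _ (dD _ _ dx))) _.
  by rewrite -mulrA ler_wpM2l.
Qed.

End InnerFluctuation.

(** * The homomorphism [mu] between the semi-groups *)

Section MuMorphism.
Variables (R : realType) (H : hilbertType R) (A : invAlgType R).
Variables (pi : representation H A) (J : antiunitary H).
Implicit Types X Y : tensor A A^c.

Notation muterm p q :=
  (tens (tens p.1 (hat pi J q.1) : AhatA pi J)
     ((tens (p.2 : A) (hat pi J (q.2 : A)) : AhatA pi J) : (AhatA pi J)^c)).

Lemma muE X :
  mu pi J X = \sum_(p <- repr X) \sum_(q <- repr X) muterm p q.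
Proof. by rewrite {1}[X]tensorE mu_sum. Qed.

Lemma mu_normalized X : normalized X -> normalized (mu pi J X).
Proof.
move=> nX; rewrite /normalized muE /tmul.
rewrite tlift_bigsum; last exact: tmul_balanced.
(* The double sum of a_p b_p tensored with the hat of a_q b_q factors: the sum over q gives 1 here,
   the sum over p gives 1 afterwards. *)
have h1 : \sum_(q <- repr X) hat pi J (q.1 * (q.2 : A)) = 1.
  rewrite -(hat1 pi J) -nX /tmul /tlift.
  rewrite [RHS](big_morph (hat pi J) (id1 := 0) (op1 := +%R)) //.
  exact: hatD.
transitivity (\sum_(p <- repr X) tens (p.1 * (p.2 : A)) (1 : hat_alg pi J)).
  apply: eq_bigr => p _; rewrite tlift_bigsum; last exact: tmul_balanced.
  rewrite -h1 [RHS](big_morph (tens (p.1 * (p.2 : A))) (id1 := 0) (op1 := +%R)).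
  - apply: eq_bigr => q _; rewrite tlift_tens; last exact: tmul_balanced.
    by rewrite mul_tens hatM.
  - exact: tensDr.
  - by apply: (addrI (tens (p.1 * (p.2 : A)) 0)); rewrite -tensDr !addr0.
rewrite tensor1E -nX /tmul /tlift.
rewrite [RHS](big_morph (fun a => tens a (1 : hat_alg pi J))
  (id1 := 0) (op1 := +%R)) //.
- by move=> a b; exact: tensDl.
- by apply: (addrI (tens 0 (1 : hat_alg pi J))); rewrite -tensDl !addr0.
Qed.

Lemma mu_selfadjoint X : selfadjoint_elt X -> selfadjoint_elt (mu pi J X).
Proof.
move=> sX; rewrite /selfadjoint_elt -{2}sX muE (swap_starE X).
(* [mu_sum] accepts any family representing the element, so [mu] of [swap_star X] can be read off
   the starred pairs. *)
pose s := [seq (star (p.2 : A), star p.1 : A^c) | p <- repr X].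
have -> : \sum_(p <- repr X) tens (star (p.2 : A)) (star p.1 : A^c) =
    \sum_(p <- s) tens p.1 p.2 by rewrite big_map.
rewrite mu_sum big_map /swap_star tlift_bigsum; last exact: swap_star_balanced.
apply: eq_bigr => p _; rewrite big_map.
rewrite tlift_bigsum; last exact: swap_star_balanced.
apply: eq_bigr => q _; rewrite tlift_tens; last exact: swap_star_balanced.
by rewrite !star_tens !hat_star.
Qed.

Lemma mu_Pert X : Pert A X -> Pert (AhatA pi J) (mu pi J X).
Proof.
by move=> [nX sX]; split; [exact: mu_normalized | exact: mu_selfadjoint].
Qed.

Lemma muM X Y : mu pi J (X * Y) = mu pi J X * mu pi J Y.
Proof.
pose s := [seq (p.1 * q.1, p.2 * q.2 : A^c) | p <- repr X, q <- repr Y].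
have -> : X * Y = \sum_(p <- s) tens p.1 p.2.
  by rewrite tensorM /s big_allpairs_dep.
rewrite mu_sum {}/s big_allpairs_dep !muE mulr_suml; apply: eq_bigr => p _.
under eq_bigr do rewrite big_allpairs_dep /=.
(* [mu (X * Y)] runs over (p, q) and (p', q'), while the product of the images groups (p, p') and
   (q, q'). *)
rewrite exchange_big /= mulr_suml; apply: eq_bigr => p' _.
rewrite mulr_sumr; apply: eq_bigr => q _.
rewrite mulr_sumr; apply: eq_bigr => q' _.
rewrite mul_tens mul_tens hatM; congr tens.
transitivity (tens (q.2 : A) (hat pi J (q'.2 : A)) *
  tens (p.2 : A) (hat pi J (p'.2 : A)) : AhatA pi J) => //.
by rewrite mul_tens -hatM.
Qed.

End MuMorphism.

(** * Conjugation of operators by an antiunitary *)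

Section Conjugation.
Variables (R : realType) (H : hilbertType R) (J : antiunitary H).

Lemma au_invD : {morph au_inv J : x y / x + y}.
Proof. by move=> x y; apply: (can_inj (au_funK J)); rewrite auD !au_invK. Qed.

Lemma au_invZ c x : au_inv J (c *: x) = c^* *: au_inv J x.
Proof. by apply: (can_inj (au_funK J)); rewrite auZ !au_invK conjCK. Qed.

Lemma auB : {morph J : x y / x - y}.
Proof. by move=> x y; apply: (addIr (J y)); rewrite -auD !subrK. Qed.

Lemma au_inv_norm x : `|au_inv J x| = `|x|.
Proof. by rewrite -(au_isometry J) au_invK. Qed.

Lemma conj_by_bounded T : bounded_op T -> bounded_op (conj_by J T).
Proof.
move=> [lT [M bM]]; split=> [c x y|].
  by rewrite /conj_by /= au_invD au_invZ lT auD auZ conjCK.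
by exists M => x; rewrite /conj_by /= au_isometry -(au_inv_norm x).
Qed.

(** The square of [J] and that of its inverse are the same sign, and the two signs cancel by
    linearity of [T]. *)
Lemma conj_by2 T x : linear T ->
  (exists s : bool, forall x, J (J x) = (-1) ^+ s *: x) ->
  conj_by J (conj_by J T) x = T x.
Proof.
move=> lT [s JJ]; rewrite /conj_by /= JJ.
have JJV : au_inv J (au_inv J x) = (-1) ^+ s *: x.
  do 2 apply: (can_inj (au_funK J)).
  by rewrite !au_invK JJ scalerA -signr_addb addbb expr0 scale1r.
by rewrite JJV (linear_scalable _ _ lT) scalerA -signr_addb addbb expr0 scale1r.
Qed.

End Conjugation.

(** * The representation of the tensor product of [A] with [hat_alg pi J] *)

Section RealTriple.
Variables (R : realType) (H : hilbertType R) (A : invAlgType R).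
Variables (pi : representation H A) (J : antiunitary H).

Hypothesis order0 : forall a b x,
  pi a (conj_by J (pi b) x) = conj_by J (pi b) (pi a x).

Lemma hat_bounded (T : hat_alg pi J) : bounded_op T.
Proof.
have [a ->] := hat_surj T; exact: conj_by_bounded (rep_bounded pi a).
Qed.

Lemma act_balanced v :
  balanced (fun (a : A) (b : hat_alg pi J) => pi a (b v)).
Proof.
split=> [b a a'|a b b'|c a b].
- exact: repD.
- by rewrite hat_opD (linear_additive (rep_linear pi a)).
- by rewrite repZ hat_opZ (linear_scalable _ _ (rep_linear pi a)).
Qed.

Lemma order0_hat a (T : hat_alg pi J) x : pi a (T x) = T (pi a x).
Proof. by have [b ->] := hat_surj T; exact: order0. Qed.

Lemma act_tens a (b : hat_alg pi J) v :
  AhatA_act pi J (tens a b) v = pi a (b v).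
Proof. by rewrite /AhatA_act tlift_tens //; exact: act_balanced. Qed.

Lemma actD (S T : AhatA pi J) v :
  AhatA_act pi J (S + T) v = AhatA_act pi J S v + AhatA_act pi J T v.
Proof. by rewrite /AhatA_act tliftD //; exact: act_balanced. Qed.

Lemma act0 v : AhatA_act pi J 0 v = 0.
Proof. by rewrite /AhatA_act tlift0 //; exact: act_balanced. Qed.

Lemma act_bounded (T : AhatA pi J) : bounded_op (AhatA_act pi J T).
Proof.
split=> [c x y|].
  rewrite /AhatA_act /tlift scaler_sumr -big_split; apply: eq_bigr => p _ /=.
  by rewrite (hat_bounded p.2).1 rep_linear.
have [|M bM] := @bounded_on_sum R H _ (repr T)
  (fun p v => pi p.1 ((p.2 : hat_alg pi J) v)) setT.
  move=> p; apply: bounded_on_comp (rep_bounded pi _) _.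
  by have [_ [M bM]] := hat_bounded p.2; exists M.
by exists M => x; exact: bM.
Qed.

Lemma actZ c (T : AhatA pi J) v :
  AhatA_act pi J (cscale c T) v = c *: AhatA_act pi J T v.
Proof.
rewrite /AhatA_act (tliftZ _ _ (act_balanced v)) /tlift scaler_sumr.
by apply: eq_bigr => p _; rewrite repZ.
Qed.

Lemma act1 v : AhatA_act pi J 1 v = v.
Proof. by rewrite tensor1E act_tens rep1 hat_op1. Qed.

(** The order-zero condition enters here, moving the hat factor of [S] past the [A] factor of
    [T]. *)
Lemma actM (S T : AhatA pi J) v :
  AhatA_act pi J (S * T) v = AhatA_act pi J S (AhatA_act pi J T v).
Proof.
elim/tensor_ind: S => [|a b S IH]; first by rewrite mul0r !act0.
rewrite mulrDl !actD IH; congr (_ + _) => {S IH}; rewrite act_tens.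
elim/tensor_ind: T => [|c d T IH].
  rewrite mulr0 !act0 (linear_at0 (hat_bounded b).1).
  by rewrite (linear_at0 (rep_linear pi a)).
rewrite mulrDr !actD IH (linear_additive (hat_bounded b).1).
rewrite (linear_additive (rep_linear pi a)); congr (_ + _).
by rewrite mul_tens !act_tens repM hat_opM order0_hat.
Qed.

Lemma act_star (T : AhatA pi J) x y :
  dotp (AhatA_act pi J T x) y = dotp x (AhatA_act pi J (star T) y).
Proof.
elim/tensor_ind: T => [|a b T IH].
  have -> : star (0 : AhatA pi J) = 0.
    by apply: (addrI (star (0 : AhatA pi J))); rewrite -starD !addr0.
  by rewrite !act0 linear0l linear0r.
rewrite starD !actD dotpDl dotpDr IH; congr (_ + _).
by rewrite star_tens !act_tens rep_star hat_adjoint order0_hat.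
Qed.

Definition AhatA_rep : representation H (AhatA pi J) :=
  @Representation R H (AhatA pi J) (AhatA_act pi J)
    act_bounded actD actZ act1 actM act_star.

End RealTriple.

(** * Real fluctuations as inner fluctuations, and their sign relation with [J] *)

Section RealFluctuation.
Variables (R : realType) (H : hilbertType R) (A : invAlgType R).
Variables (pi : representation H A) (D : operator H) (J : antiunitary H).
Hypothesis rD : real_spectral_triple pi D J.
Implicit Types X Y : tensor A A^c.

Let sD : spectral_triple pi D := rst_triple rD.
Let lD : linear_operator D.
Proof. by have [] := st_self_adjoint sD. Qed.

Local Notation rho := (AhatA_rep (rst_order0 rD)).

Lemma dom_au_inv x : dom D (au_inv J x) <-> dom D x.
Proof.
have [s [/= dE _]] := rst_sign rD.
by split; [have := congr1 (fun S : set H => S x) dE => /= ->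
          |have := congr1 (fun S : set H => S x) dE => /= <-].
Qed.

Lemma dom_conj a x : dom D x -> dom D (conj_by J (pi a) x).
Proof.
move=> /dom_au_inv dx; apply/dom_au_inv.
by rewrite /conj_by /= au_funK; exact: st_dom sD _ _ dx.
Qed.

(** Since J D J^-1 is a sign times [D], the commutator of [D] with J a J^-1 is that sign times J
    [D, a] J^-1. *)
Lemma comm_conj_bounded a : exists M : R[i], forall x, dom D x ->
  `|comm_op D (conj_by J (pi a)) x| <= M * `|x|.
Proof.
have [s [/= _ DE]] := rst_sign rD; have [M bM] := st_comm_bounded sD a.
exists M => x dx; have dx' := (dom_au_inv x).2 dx.
have DJ y : dom D y -> D y = (-1) ^+ s *: conj_by J D y.
  move=> dy; rewrite DE; last exact/dom_au_inv.
  by rewrite scalerA -signr_addb addbb expr0 scale1r.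
have cJ := (conj_by_bounded J (rep_bounded pi a)).1.
have -> : comm_op D (conj_by J (pi a)) x =
    (-1) ^+ s *: J (comm_op D (pi a) (au_inv J x)).
  rewrite /comm_op (DJ _ (dom_conj a dx)) (DJ _ dx) (linear_scalable _ _ cJ).
  rewrite -scalerBr /conj_by /= !au_funK; congr (_ *: _).
  by rewrite auB.
by rewrite normrZ normrX normrN1 expr1n mul1r au_isometry -(au_inv_norm J x) bM.
Qed.

Lemma AhatA_triple : spectral_triple rho D.
Proof.
have [aD cD dD bD] := sD.
have dT (T : hat_alg pi J) x : dom D x -> dom D (T x).
  by have [b ->] := hat_surj T; exact: dom_conj.
split=> // [T x dx|T].
  by have [] := @linear_operator_sum R H D _ (repr T)
    (fun p => pi p.1 ((p.2 : hat_alg pi J) x)) lD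
    (fun p => dD p.1 _ (dT p.2 x dx)).
have [|M bM] := @bounded_on_sum R H _ (repr T)
    (fun p => comm_op D (pi p.1 \o (p.2 : hat_alg pi J))) (dom D).
  move=> [a b] /=; have [c ->] := hat_surj b.
  have [N bN] := comm_conj_bounded c; have [P bP] := bD a.
  have [_ [Q bQ]] := conj_by_bounded J (rep_bounded pi c).
  have [S bS] := bounded_on_comp (rep_bounded pi a) (ex_intro _ N bN).
  exists (`|P| * Q + S) => x dx.
  (* Leibniz rule for the commutator with a product. *)
  have -> : comm_op D (pi a \o conj_by J (pi c)) x =
      comm_op D (pi a) (conj_by J (pi c) x) +
      pi a (comm_op D (conj_by J (pi c)) x).
    rewrite {3}/comm_op (linear_subr (rep_linear pi a)).
    by rewrite /comm_op /= addrA subrK.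
  rewrite mulrDl; apply: le_trans (ler_normD _ _) _; rewrite lerD ?bS //.
  apply: le_trans (bound_normr (bP _ (dom_conj c dx))) _.
  by rewrite -mulrA ler_wpM2l.
exists M => x dx; have := bM x dx; congr (`|_| <= _).
have [_ DS] := @linear_operator_sum R H D _ (repr T)
    (fun p => pi p.1 ((p.2 : hat_alg pi J) x)) lD
    (fun p => dD p.1 _ (dT p.2 x dx)).
by rewrite /comm_op [in RHS]/= /AhatA_act /tlift DS sumrB.
Qed.

(** [muE] expands [mu X] over [repr X], the family that both nested [tlift] of [real_fluctuation]
    run through, so terms agree one by one. *)
Lemma real_fluctuation_mu X :
  real_fluctuation pi J D X
    =op inner_fluctuation (AhatA_act pi J) D (mu pi J X).
Proof.
split=> // v dv /=; congr (_ + _).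
have bal := comm_op_balanced AhatA_triple dv.
rewrite muE tlift_bigsum //; apply: eq_bigr => p _.
rewrite tlift_bigsum //; apply: eq_bigr => q _.
rewrite tlift_tens // act_tens; congr (pi _ (conj_by J (pi _) _)).
by congr (comm_op D _ v); apply/funext => w; rewrite act_tens.
Qed.

Lemma real_fluctuationE X v : normalized X -> dom D v ->
  real_fluctuation pi J D X v = \sum_(p <- repr X) \sum_(q <- repr X)
    pi p.1 (conj_by J (pi q.1)
      (D (pi (p.2 : A) (conj_by J (pi (q.2 : A)) v)))).
Proof.
move=> nX dv; rewrite (real_fluctuation_mu X).2 //.
rewrite (inner_fluctuationE rho D v (mu_normalized pi J nX)).
have bal := sandwich_balanced AhatA_triple dv.
rewrite muE tlift_bigsum //; apply: eq_bigr => p _.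
rewrite tlift_bigsum //; apply: eq_bigr => q _.
rewrite tlift_tens // /sandwich [LHS]act_tens.
by congr (pi _ (conj_by J (pi _) (D _))); exact: act_tens.
Qed.

Lemma real_fluctuation_sign X : normalized X ->
  exists s : bool, conj_operator J (real_fluctuation pi J D X) =op
                   scale_operator ((-1) ^+ s) (real_fluctuation pi J D X).
Proof.
move=> nX; have [s [/= dE DE]] := rst_sign rD; exists s; split=> //= x dJx.
have dx := (dom_au_inv x).1 dJx; rewrite {1}/conj_by /=.
have := real_fluctuationE nX dJx; rewrite /= => ->.
have := real_fluctuationE nX dx; rewrite /= => ->.
have cJ a := (conj_by_bounded J (rep_bounded pi a)).1.
have cJJ T y : J (T y) = conj_by J T (J y) by rewrite /conj_by /= au_funK.
rewrite (big_morph J (auD J) (au0 J)) scaler_sumr.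
under eq_bigr do rewrite (big_morph J (auD J) (au0 J)).
under [RHS]eq_bigr do rewrite scaler_sumr.
(* Conjugation by [J] exchanges plain and hatted factors, so the (p, q) term becomes the (q, p) term
   up to the sign of [D]; the order-zero condition restores the order of the factors. *)
rewrite exchange_big; apply: eq_bigr => q _; apply: eq_bigr => p _.
rewrite (cJJ (pi p.1)) (cJJ (conj_by J (pi q.1))) (cJJ D) (cJJ (pi p.2)).
rewrite (cJJ (conj_by J (pi q.2))) au_invK.
rewrite (conj_by2 _ (rep_linear pi q.1) (rst_square rD)).
rewrite (conj_by2 _ (rep_linear pi q.2) (rst_square rD)).
have dz : dom D (conj_by J (pi p.2) (pi q.2 x)).
  by apply: dom_conj; exact: st_dom sD _ _ dx.
rewrite DE; last exact/dom_au_inv.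
rewrite (linear_scalable _ _ (rep_linear pi _)) (linear_scalable _ _ (cJ _)).
by rewrite -!(rst_order0 rD).
Qed.

End RealFluctuation.

(** * Transport along [=op], which ignores values outside the domain *)

Section OperatorEquality.
Variables (R : realType) (H : hilbertType R).
Implicit Types D E F : operator H.

Lemma op_eq_sym D E : D =op E -> E =op D.
Proof. by move=> [dE DE]; split=> // x; rewrite -dE => /DE. Qed.

Lemma op_eq_trans D E F : D =op E -> E =op F -> D =op F.
Proof.
move=> [dE DE] [dF EF]; split=> [|x dx]; first by rewrite dE.
by rewrite DE // EF // -dE.
Qed.

Lemma spectral_triple_op_eq (A : invAlgType R) (pi : representation H A) D E :
  D =op E -> spectral_triple pi E -> spectral_triple pi D.
Proof.
move=> [dE DE] [[[E0 EL] cE aE] [l [S [[R1 R2] cS]]] dpi bE].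
split.
- split; last 1 first.
  + move=> y z; rewrite dE; split=> [yz|[dy yz]].
      have [dy <-] : dom E y /\ E y = z.
        by apply/aE => x dx; rewrite -DE ?dE //; exact: yz.
      by split=> //; rewrite DE // dE.
    move=> x dx; rewrite DE ?dE //; apply: (aE y z).2 => //.
    by rewrite -yz DE ?dE.
  + split; rewrite dE // => c x y dx dy; have [d e] := EL c x y dx dy.
    by rewrite !DE ?dE.
  + by rewrite dE.
- exists l, S; split=> //; split=> x.
    by have [d e] := R1 x; rewrite DE dE.
  by move=> dx; rewrite DE //; apply: R2; rewrite -dE.
- by rewrite dE.
- move=> a; have [M bM] := bE a; exists M => x; rewrite dE => dx.
  by rewrite /comm_op !DE ?dE //; [exact: bM | exact: dpi].
Qed.

Lemma inner_fluctuation_op_eq (A : invAlgType R) (pi : representation H A) D E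
    (X : tensor A A^c) :
  D =op E -> (forall a x, dom D x -> dom D (pi a x)) ->
  inner_fluctuation pi D X =op inner_fluctuation pi E X.
Proof.
move=> [dE DE] dpi; split=> //= v dv; rewrite DE //; congr (_ + _).
apply: eq_bigr => p _; by rewrite /comm_op !DE //; exact: dpi.
Qed.

End OperatorEquality.

(** * The action of the semi-group on real spectral triples *)

Section RealFluctuationAction.
Variables (R : realType) (H : hilbertType R) (A : invAlgType R).
Variables (pi : representation H A) (D : operator H) (J : antiunitary H).
Hypothesis rD : real_spectral_triple pi D J.
Implicit Types X Y : tensor A A^c.

Local Notation rho := (AhatA_rep (rst_order0 rD)).

(** [A] sits inside the larger algebra as the elements [tens a 1], which act by [pi a]. *)
Lemma AhatA_triple_restrict (E : operator H) :
  spectral_triple rho E -> spectral_triple pi E.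
Proof.
move=> [aE cE dE bE].
have rhoE a : rho (tens a 1) = pi a.
  by apply/funext => x; rewrite [LHS]act_tens hat_op1.
by split=> // a; rewrite -rhoE; [exact: dE | exact: bE].
Qed.

Lemma real_fluctuation_triple X : Pert A X ->
  real_spectral_triple pi (real_fluctuation pi J D X) J.
Proof.
move=> PX; split.
- apply: spectral_triple_op_eq (real_fluctuation_mu rD X) _.
  apply: AhatA_triple_restrict.
  exact: inner_fluctuation_triple (AhatA_triple rD) (mu_Pert pi J PX).
- exact: rst_square rD.
- exact: (real_fluctuation_sign rD PX.1).
- exact: (rst_order0 rD).
Qed.

(** The action of [AhatA pi J] depends on [pi] and [J] but not on the operator, so both fluctuations
    are inner for one representation, and [muM] reduces the claim to the ordinary case. *)
Lemma real_fluctuation_comp X Y : Pert A X -> Pert A Y ->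
  real_fluctuation pi J (real_fluctuation pi J D X) Y
    =op real_fluctuation pi J D (Y * X).
Proof.
move=> PX PY; have rDX := real_fluctuation_triple PX.
apply: op_eq_trans (real_fluctuation_mu rDX Y) _.
apply: op_eq_trans (op_eq_sym (real_fluctuation_mu rD (Y * X))).
apply: op_eq_trans (inner_fluctuation_op_eq (pi := rho) _
  (real_fluctuation_mu rD X) (st_dom (AhatA_triple rD))) _.
rewrite muM; apply: (inner_fluctuation_comp (pi := rho)).
- exact: AhatA_triple.
- exact: mu_Pert.
- exact: mu_Pert.
Qed.

End RealFluctuationAction.

Theorem proposition6 (R : realType) (A : invAlgType R) :
  (* (i) *)
  (Pert A 1 /\
   (forall X Y : tensor A A^c, Pert A X -> Pert A Y -> Pert A (X * Y)) /\
   (forall X Y Z : tensor A A^c, Pert A X -> Pert A Y -> Pert A Z ->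
      X * (Y * Z) = (X * Y) * Z))
  /\
  (* (ii) *)
  (forall (H : hilbertType R) (pi : representation H A) (D : operator H),
     spectral_triple pi D ->
     forall X Y : tensor A A^c, Pert A X -> Pert A Y ->
       spectral_triple pi (inner_fluctuation pi D X) /\
       inner_fluctuation pi (inner_fluctuation pi D X) Y
         =op inner_fluctuation pi D (Y * X))
  /\
  (* (iii) *)
  (forall (H : hilbertType R) (pi : representation H A) (D : operator H)
          (J : antiunitary H),
     real_spectral_triple pi D J ->
     (forall X : tensor A A^c, Pert A X ->
        Pert (AhatA pi J) (mu pi J X)) /\
     (forall X Y : tensor A A^c, Pert A X -> Pert A Y ->
        mu pi J (X * Y) = mu pi J X * mu pi J Y) /\
     (forall X : tensor A A^c, Pert A X ->
        real_fluctuation pi J D X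
          =op inner_fluctuation (AhatA_act pi J) D (mu pi J X)) /\
     (forall X : tensor A A^c, Pert A X ->
        real_spectral_triple pi (real_fluctuation pi J D X) J) /\
     (forall X Y : tensor A A^c, Pert A X -> Pert A Y ->
        real_fluctuation pi J (real_fluctuation pi J D X) Y
          =op real_fluctuation pi J D (Y * X))).
Proof.
split; [|split].
- split; first exact: Pert1.
  by split=> [|X Y Z _ _ _]; [exact: PertM | exact: mulrA].
- move=> H pi D sD X Y PX PY; split; first exact: inner_fluctuation_triple.
  exact: inner_fluctuation_comp.
- move=> H pi D J rD; split; [|split; [|split; [|split]]] => X.
  + exact: mu_Pert.
  + by move=> Y _ _; exact: muM.
  + by move=> _; exact: real_fluctuation_mu.
  + exact: real_fluctuation_triple.
  + by move=> Y; exact: real_fluctuation_comp.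
Qed.
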